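(* Let $\Gamma$ be a finitely generated group. For a Cayley graph $G=(V,E)$ of $\Gamma$, consider the property (P) for every $p<1$ there exists a general bond percolation $\mathbf{P}$ on $G$, with configuration denoted $\omega$, such that $\mathbf{P}[e\in\omega]>p$ for every $e\in E$ and such that the two-point function vanishes at infinity, i.e. $\lim_{r\to\infty}\sup\{\mathbf{P}[u\leftrightarrow v]\colon u,v\in V,\ d(u,v)>r\}=0$, where $d$ is the graph metric of $G$. Then the following are equivalent: (a) $\Gamma$ embeds coarsely into a Hilbert space; (b) some Cayley graph of $\Gamma$ has property (P); (c) every Cayley graph of $\Gamma$ has property (P).
   Context: Given a finitely generated group $\Gamma$ and a finite symmetric generating set $S$, the Cayley graph of $\Gamma$ with respect to $S$ is the graph $G=(V,E)$ with $V=\Gamma$ and undirected edges $\{[g,gs]\colon g\in\Gamma,\ s\in S\}$. Its graph metric is the word metric with respect to $S$. A map $f\colon X\to Y$ between metric spaces is a coarse embedding if there exist non-decreasing maps $\rho_1,\rho_2\colon[0,\infty)\to[0,\infty)$ such that $\rho_1(t)\to\infty$ as $t\to\infty$ and $\rho_1(d_X(u,v))\le d_Y(f(u),f(v))\le\rho_2(d_X(u,v))$ for all $u,v\in X$. $\Gamma$ embeds coarsely into a Hilbert space if there exists a coarse embedding from $\Gamma$, equipped with some word metric (coming from a finite generating set), into some Hilbert space. A general bond percolation on a graph $G=(V,E)$ is a probability measure $\mathbf{P}$ on subsets of $E$, i.e. on $\{0,1\}^E$ with its Borel $\sigma$-algebra (no invariance is assumed). The configuration $\omega\subset E$ is identified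 with the induced subgraph with vertex set $V$ and edge set $\omega$; its connected components are called clusters. $\{u\leftrightarrow v\}$ is the event that $u$ and $v$ lie in the same cluster of $\omega$; $\tau(u,v)=\mathbf{P}[u\leftrightarrow v]$ is the two-point function. A supremum over an empty set of pairs is taken to be $0$. *)

(* Defs.v *)
From HB Require Import structures.
From mathcomp Require Import all_boot all_order all_algebra.
From mathcomp Require Import all_classical all_reals all_analysis.

Set Implicit Arguments.
Unset Strict Implicit.
Unset Printing Implicit Defensive.

Import Order.TTheory GRing.Theory Num.Theory.
Import numFieldTopology.Exports numFieldNormedType.Exports.

Local Open Scope classical_set_scope.
Local Open Scope ring_scope.

(** A graph on [V] is given by its set [E] of undirected edges; the edge
    between [u] and [v] is the set [[set u; v]] (a singleton for a loop). *)
Section Graphs.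
Variables (R : realType) (V : Type).
Implicit Types (E : set (set V)) (u v : V).

Definition adjacent E u v : bool := `[< E [set u; v] >].

Definition walk E u (p : seq V) v : Prop := path (adjacent E) u p /\ last u p = v.

(** The infimum is a minimum as soon as some walk joins [u] to [v]; it is the
    junk value 0 otherwise. *)
Definition graph_dist E u v : R :=
  inf [set (size p)%:R | p in [set p | walk E u p v]].

Definition bond_config E : Type := prod_topology (fun _ : E => bool).

HB.instance Definition _ E := Pointed.on (bond_config E).
HB.instance Definition _ E := Nbhs.on (bond_config E).
HB.instance Definition _ E := Topological.on (bond_config E).

Definition open_edges E (w : bond_config E) : set (set V) :=
  [set val e | e in [set e : E | w e]].

Definition connected_in E (w : bond_config E) u v : Prop :=
  exists p, walk (open_edges w) u p v.

Definition borel_config E := g_sigma_algebraType (@open (bond_config E)).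

Definition percolation E := probability (borel_config E) R.

Definition two_point E (P : percolation E) u v : R :=
  fine (P [set w : bond_config E | connected_in w u v]).

(** [sup] is the real supremum of the library, with [sup set0 = 0]. *)
Definition vanishes_at_infinity E (tau : V -> V -> R) : Prop :=
  sup [set tau uv.1 uv.2 | uv in [set uv : V * V | r < graph_dist E uv.1 uv.2]]
    @[r --> +oo] --> (0 : R).

Definition propertyP E : Prop :=
  forall p : R, p < 1 ->
  exists P : percolation E,
    (forall e : E, (p%:E < P [set w : bond_config E | w e])%E) /\
    vanishes_at_infinity E (two_point P).

End Graphs.

Section ConnectionMeasurable.
Variables (V : Type) (E : set (set V)).

Lemma open_edge (e : E) : open [set w : bond_config E | w e].
Proof.
have /continuousP c : continuous (proj e : bond_config E -> bool).
  exact: proj_continuous.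
by have := c [set true] (discrete_open _).
Qed.

Lemma open_connected_in u v : open [set w : bond_config E | connected_in w u v].
Proof.
have -> : [set w : bond_config E | connected_in w u v] =
    \bigcup_p [set w : bond_config E | walk (open_edges w) u p v].
  by apply/seteqP; split=> w [p]; exists p.
apply: bigcup_open => p _; elim: p u => [|x p IH] u.
  rewrite /walk /=; have [->|uv] := pselect (u = v).
    suff -> : [set w : bond_config E | true /\ v = v] = setT by exact: openT.
    by apply/seteqP; split.
  suff -> : [set w : bond_config E | true /\ u = v] = set0 by exact: open0.
  by rewrite -subset0 => w /= [_ /uv].
have -> : [set w : bond_config E | walk (open_edges w) u (x :: p) v] =
   (\bigcup_(e in [set e : E | val e = [set u; x]]) [set w : bond_config E | w e])
   `&` [set w : bond_config E | walk (open_edges w) x p v].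
  apply/seteqP; split=> w; rewrite /walk /=.
    by move=> [/andP[/asboolP[e we eux] xp] pv]; split => //; exists e.
  by move=> [[e eux we] [xp pv]]; split => //; apply/andP; split => //; apply/asboolP; exists e.
by apply: openI => //; apply: bigcup_open => e _; exact: open_edge.
Qed.

Lemma measurable_connected_in u v :
  measurable ([set w | connected_in w u v] : set (borel_config E)).
Proof. by apply: sub_sigma_algebra; exact: open_connected_in. Qed.

End ConnectionMeasurable.

Section CoarseEmbeddings.
Variable R : realType.

Definition coarse_embedding (X Y : Type) (dX : X -> X -> R) (dY : Y -> Y -> R)
    (f : X -> Y) : Prop :=
  exists rho1 rho2 : R -> R,
    [/\ forall t, 0 <= t -> 0 <= rho1 t /\ 0 <= rho2 t,
        {in `[0, +oo[ &, {homo rho1 : s t / s <= t}},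
        {in `[0, +oo[ &, {homo rho2 : s t / s <= t}},
        rho1 t @[t --> +oo] --> +oo
      & forall u v, rho1 (dX u v) <= dY (f u) (f v) <= rho2 (dX u v)].

(** The Hilbert spaces are real ones; a complex Hilbert space is also a real one,
    with the same metric. *)
Definition embeds_in_hilbert (X : Type) (dX : X -> X -> R) : Prop :=
  exists (H : completeNormedModType R) (inner : {dot H for idfun}) (f : X -> H),
    (forall x : H, inner x x = `|x| ^+ 2) /\
    coarse_embedding dX (fun x y : H => `|x - y|) f.

End CoarseEmbeddings.

Section Groups.
Variables (R : realType) (G : groupType).
Implicit Types (S : set G) (g h : G).

Definition word_for S g (s : seq G) : Prop :=
  (forall x, x \in s -> S x \/ S (x^-1)%g) /\ (\prod_(x <- s) x)%g = g.

Definition finite_generating S : Prop :=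
  finite_set S /\ forall g, exists s, word_for S g s.

Definition symmetric_set S : Prop := forall s, S s -> S (s^-1)%g.

Definition finitely_generated : Prop := exists S, finite_generating S.

Definition word_dist S g h : R :=
  inf [set (size s)%:R | s in [set s | word_for S (g^-1 * h)%g s]].

Definition coarsely_embeds_in_hilbert : Prop :=
  exists2 S, finite_generating S & embeds_in_hilbert (word_dist S).

Definition cayley_edges S : set (set G) :=
  [set e | exists g s, S s /\ e = [set g; (g * s)%g]].

Definition cayley_generating S : Prop := finite_generating S /\ symmetric_set S.

(** For symmetric [S] the word metric is the graph metric of the Cayley graph. *)
Lemma graph_dist_cayley (S : set G) g h : symmetric_set S ->
  graph_dist R (cayley_edges S) g h = word_dist S g h.
Proof.
move=> symS.
have adjE x y : adjacent (cayley_edges S) x y <-> S (x^-1 * y)%g.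
  split=> [/asboolP[a [s [Ss e]]]|Sxy]; last first.
    by apply/asboolP; exists x, (x^-1 * y)%g; rewrite mulVKg.
  have [xe ye] : [set a; (a * s)%g] x /\ [set a; (a * s)%g] y by rewrite -e; split; [left|right].
  have [ae be] : [set x; y] a /\ [set x; y] (a * s)%g by rewrite e; split; [left|right].
  move: xe ye ae be => [/= ->|/= ->] [/= ->|/= ->].
  - rewrite mulVg => _ [] /(congr1 (fun t => a^-1 * t)%g); by rewrite mulVg mulKg => <-.
  - by rewrite mulKg.
  - by rewrite invgM -mulgA mulVg mulg1 => _ _; exact: symS.
  - rewrite mulVg => [[]] /(congr1 (fun t => a^-1 * t)%g); by rewrite mulVg mulKg => ->.
have wS x : S x \/ S (x^-1)%g -> S x by move=> [//|/symS]; rewrite invgK.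
congr inf; apply/seteqP; split=> _ [p /= + <-].
  suff H : walk (cayley_edges S) g p h -> exists2 s, word_for S (g^-1 * h)%g s & size s = size p.
    by move=> /H[s sw <-]; exists s.
  elim: p g => [|x p IH] g [] /=.
    by move=> _ ->; exists [::] => //; split => //; rewrite big_nil mulVg.
  move=> /andP[/adjE gx xp pv]; have [s [sS sE] <-] := IH x (conj xp pv).
  exists (g^-1 * x :: s)%g => //; split => [y|]; last by rewrite big_cons sE -!mulgA mulVKg.
  by rewrite inE => /orP[/eqP ->|/sS//]; left.
move=> H; suff [q qw <-] : exists2 q, walk (cayley_edges S) g q h & size q = size p by exists q.
elim: p g H => [|x p IH] g [pS] /=.
  rewrite big_nil => /(congr1 (fun t => g * t)%g); rewrite mulg1 mulVKg => ->.
  by exists [::].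
rewrite big_cons => e.
have [|q [qp qh] <-] := IH (g * x)%g.
  split; first by move=> y yp; apply: pS; rewrite inE yp orbT.
  by rewrite invgM -mulgA -e mulKg.
exists (g * x :: q)%g => //; split => //=; apply/andP; split => //.
by apply/adjE; rewrite mulKg; apply: wS; apply: pS; rewrite inE eqxx.
Qed.

End Groups.

(* Main.v *)
From HB Require Import structures.
From mathcomp Require Import all_boot all_order all_algebra.
From mathcomp Require Import all_classical all_reals all_analysis.
From mathcomp Require Import ring lra.
Require Import Defs.

(** The bridge between the two sides of the equivalence is the notion of a
    positive semidefinite kernel, psd for short.

    From percolations to a Hilbert space.  Belonging to the same cluster is a
    random equivalence relation, so the two-point function [tau] is psd, and
    [1 - tau u v], the probability that [u] and [v] are disconnected, is half a
    squared Hilbert distance; it also satisfies the triangle inequality.  For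
    percolations whose edges are open with probability above [1 - 2^-(n+1)], the
    sum [psi] over [n] of these probabilities is at most the word metric.  It
    tends to infinity with the distance, because for each [n] the two-point
    function eventually drops below 1/2.  Centering turns [psi] into a psd
    kernel, and any psd kernel on a countable set is a Gram matrix in l2
    ([psd_hilbert], from the infinite Cholesky factorization [psd_factor]).  So
    [psi] is the squared distance of a map into l2, which is therefore a coarse
    embedding ([hilbert_of_percolation]).

    From a Hilbert space to percolations.  Let [f] be a coarse embedding.  By
    Schur's product theorem the Gaussian kernel [exp (- t |f u - f v|^2)] is
    psd, hence is the Gram matrix of unit vectors of l2.  The Mazur map, which
    replaces each coordinate by its signed square, is a uniform equivalence
    between the unit spheres of l2 and of l1; applying it at the scales
    [t = d^2 4^-k] and adding everything up maps the group coarsely into l1, with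
    neighbours as close as one wishes ([thresholds]).  In l1 coordinates in
    [0, 1], choose an independent uniform threshold for each coordinate, and
    record on which side of each threshold a point lies: the sides of [u] and [v]
    at one coordinate differ with probability exactly the difference of the two
    coordinates.  Declare an edge open when no threshold separates its ends
    ([percolation_of_thresholds]).  An edge is closed with probability at most
    the l1 distance of its ends, whereas points in the same cluster are not
    separated at all, which has probability at most the exponential of minus
    their l1 distance.

    Only countably many discrete choices are needed once the coordinates are
    rounded, with summable errors: the thresholds are then the mixed radix digits
    of a single uniform point of [0, 1], whose independence is elementary
    ([prob_digits]).

    The embedding does not refer to the Cayley graph, and word metrics for
    different finite generating sets are comparable, so the percolations exist on
    every Cayley graph as soon as they exist on one. *)

Set Implicit Arguments.
Unset Strict Implicit.
Unset Printing Implicit Defensive.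
Import Order.TTheory GRing.Theory Num.Theory.
Import numFieldTopology.Exports numFieldNormedType.Exports.
Local Open Scope classical_set_scope.
Local Open Scope ring_scope.

(** * Positive semidefinite kernels *)

Section PositiveSemidefinite.
Variables (R : realType) (T : eqType).
Implicit Types (K : T -> T -> R) (s : seq (R * T)).

(** The quadratic form of [K] at a finitely supported function, presented as a list
    of weighted points, so that adding a point is [cons]. *)
Definition quad K s : R :=
  \sum_(p <- s) \sum_(q <- s) p.1 * q.1 * K p.2 q.2.

Definition psd K : Prop :=
  (forall x y, K x y = K y x) /\ forall s, 0 <= quad K s.

Lemma quad_cons K t z s : (forall x y, K x y = K y x) ->
  quad K ((t, z) :: s) =
    t ^+ 2 * K z z + 2 * t * (\sum_(p <- s) p.1 * K p.2 z) + quad K s.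
Proof.
move=> sK; rewrite /quad big_cons big_cons /=.
under [X in _ + X = _]eq_bigr do rewrite big_cons /=.
rewrite big_split /= !addrA; congr (_ + _).
have -> : \sum_(j <- s) t * j.1 * K z j.2 = t * \sum_(p <- s) p.1 * K p.2 z.
  by rewrite mulr_sumr; apply: eq_bigr => p _; rewrite sK mulrA.
have -> : \sum_(i <- s) i.1 * t * K i.2 z = t * \sum_(p <- s) p.1 * K p.2 z.
  by rewrite mulr_sumr; apply: eq_bigr => p _; ring.
by ring.
Qed.

Lemma psd_diag_ge0 K x : psd K -> 0 <= K x x.
Proof.
by case=> _ /(_ [:: (1, x)]); rewrite /quad !big_seq1 /= !mul1r.
Qed.

(** Otherwise the form at [x + t z] would be affine and nonconstant in [t], hence
    negative somewhere. *)
Lemma psd_diag0 K x z : psd K -> K z z = 0 -> K x z = 0.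
Proof.
move=> pK Kz; have := pK => -[sK].
have nnK t : 0 <= 2 * t * K x z + K x x.
  have := pK.2 [:: (t, z); (1, x)].
  by rewrite quad_cons // Kz mulr0 add0r /quad !big_seq1 /= !mul1r.
have Kx := psd_diag_ge0 x pK.
move=> _; apply/eqP/negP => /negP K0.
have := nnK (- (K x x + 1) / (2 * K x z)).
have -> : 2 * (- (K x x + 1) / (2 * K x z)) * K x z + K x x = -1.
  by field.
by rewrite ler0N1.
Qed.

(** When [K z z = 0] the division convention makes this [K] itself, which is the
    right value since then [K x z = 0] as well. *)
Definition schur_complement K z : T -> T -> R :=
  fun x y => K x y - K x z * K y z / K z z.

(** The form of the Schur complement at [s] is the minimum over [t] of the form of
    [K] at [s] with [z] added with weight [t]. *)
Lemma psd_schur_complement K z : psd K -> psd (schur_complement K z).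
Proof.
move=> pK; have [sK nK] := pK.
have [Kz|Kz] := eqVneq (K z z) 0.
  suff -> : schur_complement K z = K by [].
  by apply/funext => x; apply/funext => y; rewrite /schur_complement Kz invr0 mulr0 subr0.
split=> [x y|s]; first by rewrite /schur_complement sK [K x z * _]mulrC.
pose b := \sum_(p <- s) p.1 * K p.2 z.
suff -> : quad (schur_complement K z) s = quad K ((- (b / K z z), z) :: s) by exact: nK.
rewrite quad_cons // -/b.
have -> : quad (schur_complement K z) s = quad K s - b * b / K z z.
  rewrite /quad /schur_complement /b big_distrlr /= mulr_suml -sumrB.
  apply: eq_bigr => p _; rewrite mulr_suml -sumrB.
  by apply: eq_bigr => q _; field.
by field.
Qed.

Lemma schur_complement_null K z x : psd K -> schur_complement K z x z = 0.
Proof.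
move=> pK; rewrite /schur_complement; have [Kz|Kz] := eqVneq (K z z) 0.
  by rewrite Kz mulr0 mul0r subr0 psd_diag0.
by rewrite mulfK // subrr.
Qed.

Section Cholesky.
Variables (K : T -> T -> R) (e : nat -> T).
Hypothesis pK : psd K.

Fixpoint residual n : T -> T -> R :=
  if n is m.+1 then schur_complement (residual m) (e m) else K.

Definition cholesky x m : R :=
  residual m x (e m) / Num.sqrt (residual m (e m) (e m)).

Lemma psd_residual n : psd (residual n).
Proof. by elim: n => //= n; exact: psd_schur_complement. Qed.

Lemma residual_null n m x : (m < n)%N -> residual n x (e m) = 0.
Proof.
elim: n x => // n IH x; rewrite ltnS leq_eqVlt => /orP[/eqP ->|mn] /=.
  by rewrite schur_complement_null //; exact: psd_residual.
rewrite /schur_complement IH // [residual n (e m) _](psd_residual n).1 IH //.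
by rewrite mulr0 mul0r subr0.
Qed.

Lemma cholesky_null m n : (m < n)%N -> cholesky (e m) n = 0.
Proof.
by move=> mn; rewrite /cholesky (psd_residual n).1 residual_null // mul0r.
Qed.

Lemma cholesky_residual n x y :
  K x y = residual n x y + \sum_(m < n) cholesky x m * cholesky y m.
Proof.
elim: n => [|n IH]; first by rewrite big_ord0 addr0.
rewrite IH big_ord_recr /= [\sum_(_ < n) _ + _]addrC addrA; congr (_ + _).
rewrite /schur_complement -[LHS](subrK (cholesky x n * cholesky y n)).
congr (_ - _ + _); rewrite /cholesky mulf_div -expr2 sqr_sqrtr //.
exact/psd_diag_ge0/psd_residual.
Qed.

End Cholesky.

(** Along an enumeration of the index set, iterated Schur complements give a
    lower triangular Cholesky factor, so each vector has finite support. *)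
Lemma psd_factor K (e : nat -> T) : psd K -> (forall x, exists n, e n = x) ->
  exists (N : T -> nat) (F : T -> nat -> R),
    (forall x m, (N x <= m)%N -> F x m = 0) /\
    (forall x y n, (N x <= n)%N -> K x y = \sum_(m < n) F x m * F y m).
Proof.
move=> pK /choice[j ej]; exists (fun x => (j x).+1), (cholesky K e); split=> [x m xm|x y n xn].
  by rewrite -(ej x) cholesky_null.
by rewrite (cholesky_residual e pK n) -(ej x) (psd_residual e pK n).1 residual_null // add0r.
Qed.

Lemma psd_cst : psd (fun _ _ => 1).
Proof.
split=> // s; rewrite /quad.
under eq_bigr do (under eq_bigr do rewrite mulr1).
by rewrite -big_distrlr /= -expr2 sqr_ge0.
Qed.

Lemma psdD K L : psd K -> psd L -> psd (fun x y => K x y + L x y).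
Proof.
move=> [sK nK] [sL nL]; split=> [x y|s]; first by rewrite sK sL.
suff -> : quad (fun x y => K x y + L x y) s = quad K s + quad L s by exact: addr_ge0.
rewrite /quad -big_split; apply: eq_bigr => p _ /=; rewrite -big_split.
by apply: eq_bigr => q _ /=; rewrite mulrDr.
Qed.

(** Rescaling the weights of the quadratic form by [h]. *)
Lemma psd_conj K (h : T -> R) : psd K -> psd (fun x y => h x * h y * K x y).
Proof.
move=> [sK nK]; split=> [x y|s]; first by rewrite sK [h x * _]mulrC.
suff -> : quad (fun x y => h x * h y * K x y) s = quad K [seq (p.1 * h p.2, p.2) | p <- s] by [].
rewrite /quad big_map; apply: eq_bigr => p _; rewrite big_map; apply: eq_bigr => q _ /=.
by ring.
Qed.

Lemma psdZ K c : 0 <= c -> psd K -> psd (fun x y => c * K x y).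
Proof.
move=> c0 pK; have := psd_conj (fun=> Num.sqrt c) pK.
by under eq_fun do (under eq_fun do rewrite -expr2 sqr_sqrtr //).
Qed.

(** Schur's product theorem: a Cholesky factorization of [K] writes the product as a
    finite sum of rescalings of [L]. *)
Lemma psdM K L (e : nat -> T) : (forall x, exists n, e n = x) ->
  psd K -> psd L -> psd (fun x y => K x y * L x y).
Proof.
move=> eT pK pL; split=> [x y|s]; first by rewrite pK.1 pL.1.
have [N [F [_ KF]]] := psd_factor pK eT.
pose n := \max_(p <- s) N p.2.
have -> : quad (fun x y => K x y * L x y) s =
    \sum_(m < n) quad (fun x y => F x m * F y m * L x y) s.
  rewrite /quad [RHS]exchange_big /=; apply: eq_big_seq => p ps.
  rewrite [RHS]exchange_big /=; apply: eq_bigr => q _.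
  rewrite (KF p.2 q.2 n); last exact: (leq_bigmax_seq (F := fun p : R * T => N p.2) _ ps).
  by rewrite mulr_suml mulr_sumr.
by apply: sumr_ge0 => m _; have [_] := psd_conj (F^~ m) pL; apply.
Qed.

Lemma psd_lim (K_ : nat -> T -> T -> R) K : (forall n, psd (K_ n)) ->
  (forall x y, K_ n x y @[n --> \oo] --> K x y) -> psd K.
Proof.
move=> pK cK; split=> [x y|s].
  rewrite -(cvg_lim _ (cK x y)) // -(cvg_lim _ (cK y x)) //.
  by under eq_fun do rewrite (pK _).1.
have cq : quad (K_ n) s @[n --> \oo] --> quad K s.
  apply: cvg_big => //; first exact: add_continuous.
  move=> p _; apply: cvg_big => //; first exact: add_continuous.
  by move=> q _; apply: cvgM; [exact: cvg_cst|exact: cK].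
by apply: (cvgr_to_ge cq); apply: nearW => n; exact: (pK n).2.
Qed.

Lemma psd_sum (K_ : nat -> T -> T -> R) n : (forall i, psd (K_ i)) ->
  psd (fun x y => \sum_(0 <= i < n) K_ i x y).
Proof.
move=> pK; elim: n => [|n IH].
  have := psdZ (lexx 0) psd_cst.
  by under eq_fun do (under eq_fun do rewrite mul0r); under [X in _ -> psd X]eq_fun
    do (under eq_fun do rewrite big_nil).
by under eq_fun do (under eq_fun do rewrite big_nat_recr //=); exact: psdD.
Qed.

(** The exponential series has nonnegative coefficients. *)
Lemma psd_expR K (e : nat -> T) : (forall x, exists n, e n = x) ->
  psd K -> psd (fun x y => expR (K x y)).
Proof.
move=> eT pK; apply: (@psd_lim (fun n x y => series (exp_coeff (K x y)) n)).
  move=> n; apply: psd_sum => i; rewrite /exp_coeff /=.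
  under eq_fun do (under eq_fun do rewrite mulrC).
  apply: psdZ; first by rewrite invr_ge0.
  elim: i => [|i IH]; first by under eq_fun do (under eq_fun do rewrite expr0); exact: psd_cst.
  by under eq_fun do (under eq_fun do rewrite exprS); exact: psdM eT pK IH.
by move=> x y; exact: is_cvg_series_exp_coeff.
Qed.

(** The Gaussian of the Hilbert distance that [K] defines: up to the factors
    [exp (- t K x x)] and [exp (- t K y y)], it is the exponential of [2 t K]. *)
Lemma psd_gauss K t (e : nat -> T) : (forall x, exists n, e n = x) -> 0 <= t ->
  psd K -> psd (fun x y => expR (- (t * (K x x + K y y - 2 * K x y)))).
Proof.
move=> eT t0 pK.
have p2 : psd (fun x y => 2 * t * K x y) by apply: psdZ => //; exact: mulr_ge0.
have := psd_conj (fun x => expR (- (t * K x x))) (psd_expR eT p2).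
congr psd; apply/funext => x; apply/funext => y.
by rewrite -!expRD; congr expR; ring.
Qed.

End PositiveSemidefinite.

(** The Gram matrix once the origin is moved to the vector of [o]: its form at [s] is
    that of [K] at [s] corrected by a weight at [o] making the total weight zero. *)
Lemma psd_center (R : realType) (T : eqType) (K : T -> T -> R) o : psd K ->
  psd (fun x y => K x y - K x o - K y o + K o o).
Proof.
move=> [sK nK]; split=> [x y|s]; first by rewrite sK; ring.
pose c := \sum_(p <- s) p.1; pose b := \sum_(p <- s) p.1 * K p.2 o.
suff -> : quad (fun x y => K x y - K x o - K y o + K o o) s = quad K ((- c, o) :: s) by [].
rewrite quad_cons // -/b sqrrN mulrN mulNr.
have -> : quad (fun x y => K x y - K x o - K y o + K o o) s =
    quad K s - b * c - c * b + c * c * K o o.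
  rewrite /quad /b /c !big_distrlr /= mulr_suml -!sumrB -big_split.
  apply: eq_bigr => p _ /=; rewrite mulr_suml -!sumrB -big_split.
  by apply: eq_bigr => q _ /=; ring.
by ring.
Qed.

Lemma psd_gram (R : realType) (H : lmodType R) (inner : {dot H for idfun})
    (T : eqType) (f : T -> H) :
  (forall x, 0 <= inner x x) -> psd (fun x y => inner (f x) (f y)).
Proof.
move=> i0; have iC x y : inner x y = inner y x.
  by rewrite (hermitian_subproof x y) expr0 mul1r.
split=> [x y|s]; first exact: iC.
suff -> : quad (fun x y => inner (f x) (f y)) s =
    inner (\sum_(p <- s) p.1 *: f p.2) (\sum_(p <- s) p.1 *: f p.2) by [].
have iS z : inner (\sum_(p <- s) p.1 *: f p.2) z = \sum_(p <- s) p.1 * inner (f p.2) z.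
  rewrite (big_morph (inner^~ z) (id1 := 0) (op1 := +%R)) ?linear0l //.
    by apply: eq_bigr => p _; rewrite linearZl_LR.
  by move=> x y; rewrite linearDl.
rewrite iS /quad; apply: eq_bigr => p _; rewrite iC iS mulr_sumr.
by apply: eq_bigr => q _; rewrite [inner (f q.2) _]iC mulrA.
Qed.

(** * The Hilbert space of square summable sequences *)

Section SquareSummable.
Variable R : realType.

Definition square_summable : {pred nat -> R^o} :=
  [pred x : nat -> R^o | `[< exists M : R, forall n, \sum_(i < n) (x i : R) ^+ 2 <= M >]].

Lemma square_summableP (x : nat -> R^o) :
  reflect (exists M : R, forall n, \sum_(i < n) (x i : R) ^+ 2 <= M)
          (x \in square_summable).
Proof. exact: asboolP. Qed.

Lemma square_summable_submod : submod_closed square_summable.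
Proof.
split.
  by apply/square_summableP; exists 0 => n; rewrite big1 // => i _; rewrite expr0n.
move=> a x y /square_summableP[M xM] /square_summableP[N yN].
apply/square_summableP; exists (2 * (a ^+ 2 * M) + 2 * N) => n.
apply: (@le_trans _ _ (2 * (a ^+ 2 * \sum_(i < n) (x i : R) ^+ 2)
                       + 2 * \sum_(i < n) (y i : R) ^+ 2)); last first.
  by apply: lerD; rewrite ler_pM2l // ler_wpM2l // sqr_ge0.
rewrite !mulr_sumr -big_split; apply: ler_sum => i _ /=.
rewrite [X in X ^+ 2](_ : _ = a * x i + y i) // -subr_ge0.
rewrite [leRHS](_ : _ = (a * x i - y i) ^+ 2) ?sqr_ge0 //.
by set u : R := x i; set v : R := y i; ring.
Qed.

HB.instance Definition _ := GRing.isSubmodClosed.Build R (nat -> R^o)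
  square_summable square_summable_submod.

(** Real l2, built as a subspace of [nat -> R]; boundedness of the partial sums of
    squares replaces convergence of the series in the definition of membership. *)
Record ell2 := Ell2 {
  ell2_seq :> nat -> R^o;
  ell2_summable : ell2_seq \in square_summable }.

HB.instance Definition _ := [isSub for ell2_seq].
HB.instance Definition _ := [Choice of ell2 by <:].
HB.instance Definition _ := [SubChoice_isSubLmodule of ell2 by <:].

Definition dot (x y : ell2) : R := limn (fun n => \sum_(i < n) (x i : R) * y i).

Lemma dot_cvg (x y : ell2) :
  \sum_(i < n) (x i : R) * y i @[n --> \oo] --> dot x y.
Proof.
have sq (z : ell2) : cvgn (fun n => \sum_(i < n) (z i : R) ^+ 2).
  apply: nondecreasing_is_cvgn.
    by apply/nondecreasing_seqP => n; rewrite big_ord_recr lerDl sqr_ge0.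
  have /square_summableP[M zM] := ell2_summable z.
  by exists M => _ [n _ <-].
suff : cvgn (fun n => \sum_(i < n) (x i : R) * y i) by [].
(* Polarization reduces to series of squares, which are monotone and bounded. *)
pose f n := 2^-1 * (\sum_(i < n) ((x + y) i : R) ^+ 2
  - \sum_(i < n) (x i : R) ^+ 2 - \sum_(i < n) (y i : R) ^+ 2).
have -> : (fun n => \sum_(i < n) (x i : R) * y i) = f.
  apply/funext => n; rewrite /f -!sumrB mulr_sumr; apply: eq_bigr => i _.
  rewrite [(x + y) i](_ : _ = x i + y i) //.
  by set u : R := x i; set v : R := y i; field.
by apply: is_cvgM; [exact: is_cvg_cst|apply: is_cvgB => //; exact: is_cvgB].
Qed.

Lemma dotC x y : dot x y = dot y x.
Proof.
by rewrite /dot; under eq_fun do (under eq_bigr do rewrite mulrC).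
Qed.

Lemma dot_linear y : linear_for *%R (dot^~ y).
Proof.
move=> a x z; apply/cvg_lim => //.
rewrite [X in X @ _](_ : _ = fun n => a * (\sum_(i < n) (x i : R) * y i)
                               + \sum_(i < n) (z i : R) * y i).
  by apply: cvgD; [apply: cvgM; [exact: cvg_cst|]|]; exact: dot_cvg.
apply/funext => n; rewrite mulr_sumr -big_split; apply: eq_bigr => i _ /=.
rewrite [X in X * _](_ : _ = a * x i + z i) //.
by rewrite mulrDl mulrA.
Qed.

Let dot_linear_r x : linear_for (idfun \; *%R) (dot x).
Proof. by move=> a y z; rewrite /= ![dot x _]dotC; exact: dot_linear. Qed.

Let dot_hermitian x y : dot x y = (-1) ^+ false * idfun (dot y x).
Proof. by rewrite expr0 mul1r dotC. Qed.

HB.instance Definition _ := @bilinear_isBilinear.Build R ell2 ell2 R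
  *%R (idfun \; *%R) dot (dot_linear, dot_linear_r).
HB.instance Definition _ :=
  @isHermitianSesquilinear.Build R ell2 false idfun dot dot_hermitian.

Lemma dot_partial_le (x : ell2) n : \sum_(i < n) (x i : R) ^+ 2 <= dot x x.
Proof.
have nd : nondecreasing_seq (fun n => \sum_(i < n) (x i : R) * x i).
  by apply/nondecreasing_seqP => k; rewrite big_ord_recr lerDl -expr2 sqr_ge0.
exact: (nondecreasing_cvgn_le nd (cvgP _ (@dot_cvg x x)) n).
Qed.

Lemma dot_ge0 x : 0 <= dot x x.
Proof. by have := dot_partial_le x 0; rewrite big_ord0. Qed.

Lemma dot_eq0 x : dot x x = 0 -> x = 0.
Proof.
move=> x0; apply/val_inj/funext => n /=.
have := dot_partial_le x n.+1; rewrite x0 big_ord_recr /= => xn.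
have : (x n : R) ^+ 2 <= 0.
  by apply: le_trans xn; rewrite lerDr sumr_ge0 // => i _; rewrite sqr_ge0.
by rewrite real_exprn_even_le0 ?num_real // => /eqP.
Qed.

Let dot_gt0 x : x != 0 -> 0 < dot x x.
Proof.
by move=> x0; rewrite lt_neqAle dot_ge0 andbT eq_sym; apply: contra x0 => /eqP/dot_eq0 ->.
Qed.

HB.instance Definition _ := @isDotProduct.Build R ell2 dot dot_gt0.

Lemma dot_sqr a b x y :
  dot (a *: x + b *: y) (a *: x + b *: y) =
    a ^+ 2 * dot x x + 2 * (a * b) * dot x y + b ^+ 2 * dot y y.
Proof.
have dl w : dot (a *: x + b *: y) w = a * dot x w + b * dot y w.
  by rewrite linearDl !linearZl_LR.
by rewrite dl [dot x _]dotC [dot y _]dotC !dl [dot y x]dotC; ring.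
Qed.

Definition ell2_norm x : R := Num.sqrt (dot x x).

Lemma sqr_ell2_norm x : ell2_norm x ^+ 2 = dot x x.
Proof. by rewrite sqr_sqrtr // dot_ge0. Qed.

(** Cauchy-Schwarz, from the squared norm of [|y| x - |x| y]. *)
Lemma ler_dot_norm x y : dot x y <= ell2_norm x * ell2_norm y.
Proof.
have [x0|x0] := eqVneq (ell2_norm x) 0.
  have /dot_eq0 -> : dot x x = 0 by rewrite -sqr_ell2_norm x0 expr0n.
  by rewrite linear0l mulr_ge0 ?sqrtr_ge0.
have [y0|y0] := eqVneq (ell2_norm y) 0.
  have /dot_eq0 -> : dot y y = 0 by rewrite -sqr_ell2_norm y0 expr0n.
  by rewrite linear0r mulr_ge0 ?sqrtr_ge0.
have xy : 0 < ell2_norm x * ell2_norm y.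
  by rewrite mulr_gt0 // lt_neqAle eq_sym ?x0 ?y0 sqrtr_ge0.
have := dot_ge0 (ell2_norm y *: x + (- ell2_norm x) *: y).
rewrite dot_sqr -!sqr_ell2_norm.
set a := ell2_norm x in xy *; set b := ell2_norm y in xy *; set d := dot x y.
have -> : b ^+ 2 * a ^+ 2 + 2 * (b * - a) * d + (- a) ^+ 2 * b ^+ 2 =
  2 * (a * b) * (a * b - d) by ring.
by rewrite pmulr_rge0 ?subr_ge0 // mulr_gt0.
Qed.

Let ler_ell2_normD x y : ell2_norm (x + y) <= ell2_norm x + ell2_norm y.
Proof.
rewrite -ler_sqr ?nnegrE ?addr_ge0 ?sqrtr_ge0 //.
have := dot_sqr 1 1 x y; rewrite !scale1r sqr_ell2_norm sqrrD !sqr_ell2_norm => ->.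
have := ler_dot_norm x y; lra.
Qed.

Let ell2_normZ a x : ell2_norm (a *: x) = `|a| * ell2_norm x.
Proof.
have := dot_sqr a 0 x 0; rewrite scale0r addr0 /ell2_norm => ->.
by rewrite mulr0 mulr0 mul0r expr0n mul0r !addr0 sqrtrM ?sqr_ge0 // sqrtr_sqr.
Qed.

Let ell2_norm_eq0 x : ell2_norm x = 0 -> x = 0.
Proof. by move=> x0; apply: dot_eq0; rewrite -sqr_ell2_norm x0 expr0n. Qed.

HB.instance Definition _ := Lmodule_isNormed.Build R ell2
  ler_ell2_normD ell2_normZ ell2_norm_eq0.

Lemma ell2_partial_le (x : ell2) n : \sum_(i < n) (x i : R) ^+ 2 <= `|x| ^+ 2.
Proof. by rewrite sqr_ell2_norm; exact: dot_partial_le. Qed.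

Lemma ell2_norm_le (x : ell2) (M : R) : 0 <= M ->
  (forall n, \sum_(i < n) (x i : R) ^+ 2 <= M ^+ 2) -> `|x| <= M.
Proof.
move=> M0 xM; rewrite -ler_sqr ?nnegrE ?sqrtr_ge0 // sqr_ell2_norm.
apply: (cvgr_to_le (@dot_cvg x x)); apply: nearW => n.
by have := xM n; under eq_bigr do rewrite expr2.
Qed.

Lemma ell2_coord_le (x : ell2) i : `|x i : R| <= `|x|.
Proof.
rewrite -ler_sqr ?nnegrE ?normr_ge0 // real_normK ?num_real //.
apply: le_trans (ell2_partial_le x i.+1); rewrite big_ord_recr lerDr.
by apply: sumr_ge0 => j _; exact: sqr_ge0.
Qed.

(** The limit is coordinatewise.  A ball inequality between members of the filter
    passes to this limit on each partial sum, hence on the whole sum. *)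
Let ell2_complete (F : set_system ell2) : ProperFilter F -> cauchy F -> cvg F.
Proof.
move=> FF /cauchyP Fc.
have {}Fc (e : R) : 0 < e -> exists z : ell2, \forall x \near F, `|z - x| <= e.
  move=> /Fc[z zF]; exists z; apply: filterS zF => x.
  by rewrite -ball_normE /= => /ltW.
have Fci i : cvg ((fun x : ell2 => x i : R) @ F).
  apply/cauchy_cvgP/cauchyP => e e0.
  have [|z zF] := Fc (e / 2); first by rewrite divr_gt0.
  exists (z i); apply: filterS zF => x /= zx; rewrite -ball_normE /=.
  rewrite (le_lt_trans (ell2_coord_le (z - x) i)) // (le_lt_trans zx) //.
  by rewrite gtr_pMr // invf_lt1 // ltr1n.
pose y : nat -> R^o := fun i => lim ((fun x : ell2 => x i : R) @ F).
have Fy (z : ell2) (e : R) : 0 <= e -> (\forall x \near F, `|z - x| <= e) ->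
    forall n, \sum_(i < n) ((z i : R) - y i) ^+ 2 <= e ^+ 2.
  move=> e0 zF n.
  have c : (fun x : ell2 => \sum_(i < n) ((z i : R) - x i) ^+ 2) @ F -->
      \sum_(i < n) ((z i : R) - y i) ^+ 2.
    apply: cvg_big => //; first exact: add_continuous.
    have ci i : (fun x : ell2 => (z i : R) - x i) @ F --> (z i : R) - y i.
      by apply: cvgB; [exact: cvg_cst|exact: Fci].
    by move=> i _; rewrite expr2; under eq_cvg do rewrite expr2; exact: cvgM.
  apply: (cvgr_to_le c); apply: filterS zF => x zx.
  by apply: (le_trans (ell2_partial_le (z - x) n)); rewrite ler_sqr ?nnegrE.
have [z1 z1F] := Fc _ ltr01.
have yS : y \in square_summable.
  rewrite (_ : y = \val z1 - (\val z1 - y)); last by rewrite opprB addrC subrK.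
  apply: rpredB; first exact: ell2_summable.
  by apply/square_summableP; exists (1 ^+ 2); exact: Fy.
apply/cvg_ex; exists (Ell2 yS); apply/cvgrPdist_le => e e0.
have [|z zF] := Fc (e / 2); first by rewrite divr_gt0.
have zy : `|z - Ell2 yS| <= e / 2.
  by apply: ell2_norm_le; [rewrite ltW // divr_gt0|apply: Fy; rewrite // ltW // divr_gt0].
near=> x; have zx : `|z - x| <= e / 2 by near: x.
rewrite -[_ - x](subrKA z) (splitr e) (le_trans (ler_normD _ _)) // lerD //.
by rewrite distrC.
Unshelve. all: by end_near. Qed.

HB.instance Definition _ := Uniform_isComplete.Build ell2 ell2_complete.

(** The vectors are the rows of the Cholesky factor, so the inner product series
    are finite. *)
Lemma psd_hilbert (T : eqType) (K : T -> T -> R) (e : nat -> T) :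
  psd K -> (forall x, exists n, e n = x) ->
  exists f : T -> ell2, forall x y, dot (f x) (f y) = K x y.
Proof.
move=> pK eT; have [N [F [F0 KF]]] := psd_factor pK eT.
have sF x : (F x : nat -> R^o) \in square_summable.
  apply/square_summableP; exists (K x x) => n.
  rewrite (KF x x (maxn n (N x))) ?leq_maxr //.
  rewrite -(big_mkord xpredT (fun i => F x i ^+ 2)) -(big_mkord xpredT (fun i => F x i * F x i)).
  rewrite [leRHS](big_cat_nat _ (n := n)) ?leq_maxl //=.
  under [X in _ <= X + _]eq_bigr do rewrite -expr2.
  by rewrite lerDl sumr_ge0 // => i _; rewrite -expr2 sqr_ge0.
exists (fun x => Ell2 (sF x)) => x y; apply/cvg_lim => //.
apply: cvg_near_cst; exists (N x) => // n /= xn.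
by rewrite (KF x y n).
Qed.

End SquareSummable.

(** * Independent digits of a uniform point *)

Definition uniform01 (R : realType) : probability _ R := uniform_prob (@ltr01 R).

Section Digits.
Variables (R : realType) (b : nat -> nat).
Hypothesis b_gt0 : forall j, (0 < b j)%N.

Local Notation P := (uniform01 R).

Lemma uniform01E (A : set R) : measurable A ->
  P A = lebesgue_measure (A `&` `[0, 1]).
Proof.
move=> mA; rewrite [LHS](_ : _ = uniform_prob (@ltr01 R) A) // /uniform_prob integral_uniform_pdf.
rewrite (eq_integral (cst 1%:E)) ?integral_cst ?mul1e //; first exact: measurableI.
by move=> x; rewrite inE => -[_] /=; rewrite in_itv /= /uniform_pdf => ->; rewrite subr0 invr1.
Qed.

Definition radix n : nat := \prod_(j < n) b j.

Lemma radixS n : radix n.+1 = (radix n * b n)%N.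
Proof. by rewrite /radix big_ord_recr. Qed.

Lemma radix_gt0 n : (0 < radix n)%N.
Proof. by rewrite /radix prodn_gt0. Qed.

Let radix_gt0R n : 0 < (radix n)%:R :> R.
Proof. by rewrite ltr0n radix_gt0. Qed.

(** For [u] in [0, 1), the integer whose mixed radix digits are the first [n] digits
    of [u]. *)
Definition leading n (u : R) : nat := Num.truncn ((radix n)%:R * u).

Definition digit j (u : R) : nat := (leading j.+1 u %% b j)%N.

Lemma leadingS_divn n u : (leading n.+1 u %/ b n)%N = leading n u.
Proof.
(* [truncn] vanishes at negative reals. *)
have [u0|u0] := ltP u 0.
  have z k : leading k u = 0%N.
    by apply/Num.Theory.truncn0Pn; rewrite -ltNge (lt_trans _ ltr01) // pmulr_rlt0.
  by rewrite !z div0n.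
have v0 : 0 <= (radix n)%:R * u by rewrite mulr_ge0.
apply/esym/truncn_def; rewrite /leading radixS.
set v := (radix n)%:R * u in v0 *.
have -> : (radix n * b n)%:R * u = (b n)%:R * v by rewrite natrM mulrAC mulrC.
set m := (Num.truncn _ %/ b n)%N.
have bR : 0 < (b n)%:R :> R by rewrite ltr0n.
have w0 : 0 <= (b n)%:R * v by rewrite mulr_ge0.
rewrite -(ler_pM2l bR) -[X in _ && X](ltr_pM2l bR) -!natrM -truncn_ge_nat // -truncn_lt_nat //.
by rewrite mulnC leq_trunc_div mulnC ltn_ceil.
Qed.

Lemma measurable_leading n (C : pred nat) : measurable [set u : R | C (leading n u)].
Proof.
have mgt m : measurable [set u : R | (m < leading n u)%N].
  rewrite (_ : [set u | _] = `[m.+1%:R / (radix n)%:R, +oo[%classic); first by [].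
  apply/seteqP; split=> u /=; rewrite in_itv /= andbT /leading truncn_gt_nat;
    by rewrite ler_pdivrMr // mulrC.
rewrite (_ : [set u | _] = \bigcup_(m in [set m | C m]) [set u | leading n u = m]).
  apply: bigcup_measurable => -[|m] _.
    rewrite (_ : [set u | _] = ~` [set u | (0 < leading n u)%N]); first exact: measurableC.
    by apply/seteqP; split=> u /=; [move=> ->|case: (leading n u)].
  rewrite (_ : [set u | _] = [set u | (m < leading n u)%N] `\`
     [set u | (m.+1 < leading n u)%N]); first exact: measurableD.
  apply/seteqP; split=> u /=; first by move=> ->; split; rewrite ?ltnn.
  by move=> [ml /negP]; rewrite -leqNgt => lm; apply/eqP; rewrite eqn_leq ml lm.
apply/seteqP; split=> [u Cu|u [m /= Cm ->//]]; by exists (leading n u).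
Qed.

Lemma prob_leading_eq n m : (m < radix n)%N ->
  P [set u | leading n u = m] = ((radix n)%:R^-1)%:E.
Proof.
move=> mn; rewrite uniform01E; last first.
  by have := measurable_leading n (pred1 m); congr measurable;
    apply/seteqP; split=> u /= /eqP.
have N0 := radix_gt0R n.
rewrite (_ : _ `&` _ = `[m%:R / (radix n)%:R, m.+1%:R / (radix n)%:R[%classic).
  rewrite lebesgue_measure_itv /= lte_fin ltr_pM2r ?invr_gt0 // ltr_nat ltnSn.
  by rewrite -EFinB -mulrBl -natrB // subSnn mul1r.
apply/seteqP; split=> u /=; rewrite !in_itv /=.
  move=> [<- /andP[u0 _]]; have /truncn_itv : 0 <= (radix n)%:R * u by rewrite mulr_ge0.
  by rewrite ler_pdivrMr // ltr_pdivlMr // [u * _]mulrC.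
rewrite ler_pdivrMr // ltr_pdivlMr // [u * _]mulrC => /andP[mu um]; split.
  by apply: truncn_def; rewrite mu.
have u0 : 0 <= u by rewrite -(pmulr_rge0 _ N0) (le_trans _ mu).
rewrite u0 -(ler_pM2l N0) mulr1 ltW // (lt_le_trans um) // ler_nat //.
Qed.

Lemma prob_leading n (C : pred nat) :
  P [set u | C (leading n u)] = ((\sum_(m < radix n) C m)%N%:R / (radix n)%:R)%:E.
Proof.
pose A (m : 'I_(radix n)) := [set u : R | leading n u = m].
have mA m : measurable (A m).
  by have := measurable_leading n (pred1 (m : nat)); congr measurable;
    apply/seteqP; split=> u /= /eqP.
(* The endpoint [u = 1], where [leading n u = radix n], is negligible. *)
pose Z := [set u : R | C (leading n u) && (radix n <= leading n u)%N].
have mZ : measurable Z := measurable_leading n (fun m => C m && (radix n <= m)%N).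
have Z0 : P Z = 0.
  apply/eqP; rewrite eq_le measure_ge0 andbT uniform01E //.
  rewrite -(lebesgue_measure_set1 (1 : R)) le_measure ?inE //; first exact: measurableI.
  move=> u [/= /andP[_ nu]]; rewrite in_itv /= => /andP[u0 u1].
  apply/eqP; rewrite eq_le u1 -(ler_pM2l (radix_gt0R n)) mulr1.
  by rewrite -truncn_ge_nat // mulr_ge0.
rewrite (_ : [set u | _] = \big[setU/set0]_(m < radix n | C m) A m `|` Z).
  rewrite measureU0 //; last by apply: bigsetU_measurable => i _; exact: mA.
  rewrite measure_bigsetU_ord //; last first.
    by move=> i j _ _ [u [/= ui uj]]; apply/val_inj; rewrite /= -ui -uj.
  rewrite (eq_bigr (fun=> ((radix n)%:R^-1)%:E)); last by move=> i _; exact: prob_leading_eq.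
  rewrite sumEFin big_mkcond natr_sum mulr_suml; congr EFin; apply: eq_bigr => m _.
  by case: (C m); rewrite ?mul1r ?mul0r.
apply/seteqP; split=> u /=.
  have [nu|nu] := leqP (radix n) (leading n u); first by move=> Cu; right; apply/andP.
  by move=> Cu; left; rewrite -bigcup_seq_cond; exists (Ordinal nu) => //=; rewrite mem_index_enum.
move=> [|/andP[]//].
by rewrite -bigcup_seq_cond => -[m /= /andP[_ Cm] ->].
Qed.

(** The condition that [A] imposes on the first [n] digits of [u], read off the
    integer [leading n u] instead of [u]. *)
Fixpoint digitwise (A : nat -> pred nat) n : pred nat :=
  if n is k.+1 then fun m => digitwise A k (m %/ b k)%N && A k (m %% b k)%N
  else predT.

Lemma digitwise_leading A n u :
  digitwise A n (leading n u) <-> forall j, (j < n)%N -> A j (digit j u).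
Proof.
elim: n => [|n IH] //=; rewrite leadingS_divn; split.
  move=> /andP[/IH An Au] j; rewrite ltnS leq_eqVlt => /orP[/eqP ->//|]; exact: An.
move=> An; apply/andP; split; last exact: An.
by apply/IH => j jn; apply: An; rewrite ltnW.
Qed.

(** Pairs of quotient and remainder are counted independently. *)
Lemma sum_divn_modn (X Y : pred nat) a c : (0 < c)%N ->
  (\sum_(m < a * c) (X (m %/ c) && Y (m %% c)) =
  (\sum_(q < a) X q) * (\sum_(r < c) Y r))%N.
Proof.
move=> c0; elim: a => [|a IH]; first by rewrite !big_ord0.
rewrite big_ord_recr mulnDl -IH mulSnr /=.
rewrite -!(big_mkord xpredT (fun m => nat_of_bool (X (m %/ c)%N && Y (m %% c)%N))).
rewrite (big_cat_nat _ (n := (a * c)%N)) ?leq_addr //=; congr addn.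
rewrite -[X in \sum_(X <= _ < _) _]add0n big_addn addKn big_mkord big_distrr /=.
apply: eq_bigr => r _; rewrite addnC divnMDl // modnMDl divn_small // addn0 modn_small //.
by case: (X a); rewrite ?mul1n ?mul0n.
Qed.

Lemma count_digitwise A n :
  (\sum_(m < radix n) digitwise A n m = \prod_(j < n) \sum_(r < b j) A j r)%N.
Proof.
elim: n => [|n IH]; first by rewrite big_ord0 /radix big_ord0 big_ord1.
by rewrite big_ord_recr -IH radixS sum_divn_modn.
Qed.

(** The digits of a uniform point are independent and uniform, since a condition on
    the first [n] of them is a condition on the uniform integer [leading n u]. *)
Lemma prob_digits (A : nat -> pred nat) n :
  P [set u | forall j, (j < n)%N -> A j (digit j u)] =
  (\prod_(j < n) ((\sum_(r < b j) A j r)%N%:R / (b j)%:R))%:E.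
Proof.
rewrite (_ : [set u | _] = [set u | digitwise A n (leading n u)]); last first.
  by apply/seteqP; split=> u /= /digitwise_leading.
rewrite prob_leading count_digitwise prodf_div; congr EFin.
by rewrite natr_prod /radix natr_prod.
Qed.

Lemma measurable_digit j (C : pred nat) : measurable [set u : R | C (digit j u)].
Proof. exact: (measurable_leading j.+1 (fun m => C (m %% b j)%N)). Qed.

End Digits.

(** * A coarse embedding into l1, in threshold form *)

Section EllOne.
Variable R : realType.

Lemma ler_sum_uniq (I : eqType) (s t : seq I) (g : I -> R) :
  uniq s -> {subset s <= t} -> (forall i, 0 <= g i) ->
  \sum_(i <- s) g i <= \sum_(i <- t) g i.
Proof.
move=> + + g0; elim: s t => [|x s IH] t /=.
  by rewrite big_nil sumr_ge0.
move=> /andP[xs us] st; have xt : x \in t by apply: st; rewrite mem_head.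
rewrite big_cons [leRHS](big_rem x) //= lerD2l IH // => y ys.
have : y \in x :: rem x t by rewrite -(perm_mem (perm_to_rem xt)) st // inE ys orbT.
by rewrite inE => /orP[/eqP yx|//]; rewrite -yx ys in xs.
Qed.

Lemma sum_iota (h : nat -> R) n : \sum_(k <- iota 0 n) h k = \sum_(k < n) h k.
Proof. by rewrite -(big_mkord xpredT) /index_iota subn0. Qed.

Lemma sum_pickle_inv (g : nat * nat -> R) n :
  \sum_(j < n) oapp g 0 (pickle_inv j) =
  \sum_(i <- pmap pickle_inv (iota 0 n)) g i.
Proof.
rewrite -(sum_iota (fun j => oapp g 0 (pickle_inv j))).
elim: (iota 0 n) => [|j s IH] /=; first by rewrite !big_nil.
by rewrite big_cons IH; case: (pickle_inv j) => [i|] /=; rewrite ?big_cons ?add0r.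
Qed.

(** Sums over an enumeration of pairs are compared with sums over rectangles: each
    is contained in one of the other kind. *)
Lemma sum_pickle_inv_le (g : nat * nat -> R) (B : R) : (forall i, 0 <= g i) ->
  (forall K M, \sum_(k < K) \sum_(m < M) g (k : nat, m : nat) <= B) ->
  forall n, \sum_(j < n) oapp g 0 (pickle_inv j) <= B.
Proof.
move=> g0 gB n; rewrite sum_pickle_inv; set s := pmap _ _.
pose K := (\max_(i <- s) i.1).+1; pose M := (\max_(i <- s) i.2).+1.
apply: le_trans (gB K M).
have -> : \sum_(k < K) \sum_(m < M) g (k : nat, m : nat) =
    \sum_(i <- [seq (k, m) | k <- iota 0 K, m <- iota 0 M]) g i.
  by rewrite big_allpairs sum_iota; apply: eq_bigr => k _; rewrite sum_iota.
apply: ler_sum_uniq => //.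
  by apply: (pmap_uniq (@pickle_invK _)); exact: iota_uniq.
move=> [k m] kms; apply: allpairs_f; rewrite mem_iota /= ltnS.
  exact: (leq_bigmax_seq (F := fun i : nat * nat => i.1) (k, m) kms).
exact: (leq_bigmax_seq (F := fun i : nat * nat => i.2) (k, m) kms).
Qed.

Lemma sum_pickle_inv_ge (g : nat * nat -> R) K M : (forall i, 0 <= g i) ->
  exists n, \sum_(k < K) \sum_(m < M) g (k : nat, m : nat) <=
            \sum_(j < n) oapp g 0 (pickle_inv j).
Proof.
move=> g0; pose t := [seq (k, m) | k <- iota 0 K, m <- iota 0 M].
pose n := (\max_(i <- t) pickle i).+1; exists n; rewrite sum_pickle_inv.
have -> : \sum_(k < K) \sum_(m < M) g (k : nat, m : nat) = \sum_(i <- t) g i.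
  by rewrite big_allpairs sum_iota; apply: eq_bigr => k _; rewrite sum_iota.
apply: ler_sum_uniq => //.
  by apply: allpairs_uniq; [exact: iota_uniq|exact: iota_uniq|move=> [? ?] [? ?]].
move=> i it; rewrite mem_pmap; apply/mapP; exists (pickle i); last by rewrite pickleK_inv.
by rewrite mem_iota /= ltnS; exact: (leq_bigmax_seq (F := @pickle _)).
Qed.

(** The signed square [x |-> x * `|x|] is the Mazur map from l2 to l1.  Summed over
    the coordinates of two unit vectors at l2 distance [r], this bounds the l1
    distance of their images by [r^2 / (2 d) + 2 d], where [d] is a free parameter
    of the order of [r]; it stands in for Cauchy-Schwarz. *)
Lemma signed_sqr_le (d u v : R) : 0 < d ->
  2 * d * `|u * `|u| - v * `|v| | <= (u - v) ^+ 2 + 2 * d ^+ 2 * (u ^+ 2 + v ^+ 2).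
Proof.
move=> d0; rewrite -[2 * d]gtr0_norm ?mulr_gt0 // -normrM ler_norml.
have h1 := sqr_ge0 (u - v - d * (u + v)); have h2 := sqr_ge0 (u - v + d * (u + v)).
have h3 := sqr_ge0 (d * (u - v)).
have h4 : 0 <= (u ^+ 2 + v ^+ 2) * ((1 - d) ^+ 2 + d ^+ 2).
  by rewrite mulr_ge0 // addr_ge0 ?sqr_ge0.
have h5 : 0 <= d * (u ^+ 2 + v ^+ 2) by rewrite mulr_ge0 ?(ltW d0) ?addr_ge0 ?sqr_ge0.
have [u0|/ltW u0] := leP 0 u; have [v0|/ltW v0] := leP 0 v;
  rewrite ?(ger0_norm u0) ?(ger0_norm v0) ?(ler0_norm u0) ?(ler0_norm v0).
- by apply/andP; split; lra.
- have h6 : 0 <= u * - v by rewrite mulr_ge0 // oppr_ge0.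
  by apply/andP; split; lra.
- have h6 : 0 <= - u * v by rewrite mulr_ge0 // oppr_ge0.
  by apply/andP; split; lra.
- by apply/andP; split; lra.
Qed.

Lemma signed_sqr_ge (u v : R) :
  2^-1 * (u - v) ^+ 2 <= `|u * `|u| - v * `|v| |.
Proof.
wlog uv : u v / v <= u.
  by move=> H; have [|/ltW] := leP v u; [exact: H|move=> /H; rewrite distrC -sqrrN opprB].
have h := sqr_ge0 (u + v).
apply: le_trans (ler_norm _).
have uv0 : 0 <= u - v by rewrite subr_ge0.
have [v0|/ltW v0] := leP 0 v.
  have u0 := le_trans v0 uv; rewrite !ger0_norm //.
  have := mulr_ge0 uv0 u0; have := mulr_ge0 uv0 v0; lra.
have [u0|/ltW u0] := leP 0 u.
  by rewrite (ger0_norm u0) (ler0_norm v0); lra.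
rewrite !ler0_norm //; have u1 : 0 <= - u by rewrite oppr_ge0.
have v1 : 0 <= - v by rewrite oppr_ge0.
have := mulr_ge0 uv0 u1; have := mulr_ge0 uv0 v1; lra.
Qed.

Lemma truncn_dist (p q : R) : 0 <= p -> 0 <= q ->
  `|p - q| - 1 <= `|(Num.truncn p)%:R - (Num.truncn q)%:R| <= `|p - q| + 1.
Proof.
move=> /truncn_itv /andP[]; set a := (Num.truncn p)%:R; rewrite -natr1 -/a => pa ap.
move=> /truncn_itv /andP[]; set b := (Num.truncn q)%:R; rewrite -natr1 -/b => qb bq.
have [|/ltW] := leP 0 (p - q); have [|/ltW] := leP 0 (a - b) => h1 h2;
  rewrite ?(ger0_norm h1) ?(ger0_norm h2) ?(ler0_norm h1) ?(ler0_norm h2);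
  by apply/andP; split; lra.
Qed.

Lemma ler_sum_widen (u : nat -> R) m n : (forall i, 0 <= u i) -> (m <= n)%N ->
  \sum_(i < m) u i <= \sum_(i < n) u i.
Proof.
move=> u0 mn; rewrite -!sum_iota; apply: ler_sum_uniq; rewrite ?iota_uniq //.
by move=> i; rewrite !mem_iota /= !add0n => /leq_trans; exact.
Qed.

Lemma sum_half_le n : \sum_(i < n) (2^-1 : R) ^+ i <= 2.
Proof.
suff -> : \sum_(i < n) (2^-1 : R) ^+ i = 2 - 2 * 2^-1 ^+ n.
  by rewrite gerBl mulr_ge0 // exprn_ge0.
elim: n => [|n IH]; first by rewrite big_ord0 expr0 mulr1 subrr.
by rewrite big_ord_recr /= IH exprS; field.
Qed.

(** For [p] and [q] at most [b], the probability that exactly one of them exceeds a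
    uniform element of [{0, ..., b - 1}]. *)
Definition gap (b p q : nat) : R := `|p%:R - q%:R| / b%:R.

Section Thresholds.
Variables (V : eqType) (K : V -> V -> R) (e : nat -> V).
Hypotheses (pK : psd K) (eV : forall x, exists n, e n = x).

Definition sqdist x y : R := K x x + K y y - 2 * K x y.

(** One scale.  The unit vectors [F x] factor the Gaussian kernel of parameter [d^2];
    their Mazur images, moved affinely into [0, 1], are rounded to multiples of
    [1 / (B 2^m)] in coordinate [m], for a total error of at most [2 / B]. *)
Lemma scale_thresholds (d : R) (B : nat) : 0 < d -> (0 < B)%N ->
  exists a : nat -> V -> nat,
  [/\ forall m x, (a m x <= B * 2 ^ m)%N,
      forall x y M, \sum_(m < M) gap (B * 2 ^ m) (a m x) (a m y)
        <= d * (sqdist x y / 2 + 1) + 2 / B%:R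
    & forall x y, 3 <= d ^+ 2 * sqdist x y -> exists M,
        3 / 8 - 2 / B%:R <= \sum_(m < M) gap (B * 2 ^ m) (a m x) (a m y)].
Proof.
move=> d0 B0.
have [N [F [F0 GF]]] := psd_factor (psd_gauss eV (sqr_ge0 d) pK) eV.
pose G x y := expR (- (d ^+ 2 * sqdist x y)).
have {}GF x y n : (N x <= n)%N -> G x y = \sum_(m < n) F x m * F y m by exact: GF.
have G1 x : G x x = 1 by rewrite /G /sqdist (_ : _ + _ - _ = 0) ?mulr0 ?oppr0 ?expR0 //; ring.
have F1 x n : \sum_(m < n) F x m ^+ 2 <= 1.
  apply: (@le_trans _ _ (\sum_(m < maxn n (N x)) F x m ^+ 2)).
    by apply: (@ler_sum_widen (fun m => F x m ^+ 2)); rewrite ?leq_maxl // => i; exact: sqr_ge0.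
  by rewrite -(G1 x) (GF x x _ (leq_maxr n (N x))); under eq_bigr do rewrite expr2.
have Fle1 x m : `|F x m| <= 1.
  rewrite -ler_sqr ?nnegrE // real_normK ?num_real // expr1n.
  by apply: le_trans (F1 x m.+1); rewrite big_ord_recr lerDr sumr_ge0 // => i _; exact: sqr_ge0.
have dF x y n : (N x <= n)%N -> (N y <= n)%N ->
    \sum_(m < n) (F x m - F y m) ^+ 2 = 2 - 2 * G x y.
  move=> xn yn; have -> : 2 - 2 * G x y = G x x + G y y - 2 * G x y by rewrite !G1.
  rewrite (GF x x n) // (GF y y n) // (GF x y n) // -big_split /= mulr_sumr -sumrB.
  by apply: eq_bigr => m _; ring.
have dFle x y n : \sum_(m < n) (F x m - F y m) ^+ 2 <= 2 - 2 * G x y.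
  rewrite -(dF x y (maxn n (maxn (N x) (N y)))) ?leq_max ?leqnn ?orbT //.
  apply: (@ler_sum_widen (fun m => (F x m - F y m) ^+ 2)); rewrite ?leq_maxl //.
  by move=> i; exact: sqr_ge0.
(* In [0, 1] since a unit vector has coordinates of absolute value at most 1. *)
pose f x m : R := (1 + F x m * `|F x m|) / 2.
have f01 x m : 0 <= f x m <= 1.
  have : `|F x m * `|F x m| | <= 1 by rewrite normrM normr_id mulr_ile1.
  by rewrite ler_norml /f => /andP[? ?]; apply/andP; split; lra.
pose b m : R := (B * 2 ^ m)%:R.
have b0 m : 0 < b m by rewrite ltr0n muln_gt0 B0 expn_gt0.
exists (fun m x => Num.truncn (b m * f x m)).
have bE m : (b m)^-1 = B%:R^-1 * 2^-1 ^+ m by rewrite /b natrM natrX invfM exprVn.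
have sumb M : \sum_(m < M) (b m)^-1 <= 2 / B%:R.
  under eq_bigr do rewrite bE; rewrite -mulr_sumr mulrC ler_wpM2r ?invr_ge0 //.
  exact: sum_half_le.
have aq x y m := truncn_dist
  (mulr_ge0 (ltW (b0 m)) (andP (f01 x m)).1) (mulr_ge0 (ltW (b0 m)) (andP (f01 y m)).1).
have fd x y m : `|b m * f x m - b m * f y m| =
    b m * (2^-1 * `|F x m * `|F x m| - F y m * `|F y m| |).
  rewrite -mulrBr normrM gtr0_norm //; congr (_ * _).
  have -> : f x m - f y m = 2^-1 * (F x m * `|F x m| - F y m * `|F y m|).
    by rewrite /f; field.
  by rewrite normrM gtr0_norm ?invr_gt0.
split=> [m x|x y n|x y xy].
- rewrite -(ler_nat R) -/(b m); apply: (@le_trans _ _ (b m * f x m)).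
    have /andP[fx _] := f01 x m.
    by have /truncn_itv/andP[] : 0 <= b m * f x m by rewrite mulr_ge0 // ltW.
  by rewrite ger_pMr //; have /andP[] := f01 x m.
- apply: (@le_trans _ _ (\sum_(m < n) (2^-1 * `|F x m * `|F x m| - F y m * `|F y m| | + (b m)^-1))).
    apply: ler_sum => m _; rewrite /gap -/(b m) ler_pdivrMr // mulrDl mulVf ?gt_eqF //.
    by rewrite [_ * b m]mulrC -fd; have /andP[] := aq x y m.
  rewrite big_split /=; apply: lerD; last exact: sumb.
  have h : 2 * d * \sum_(m < n) 2^-1 * `|F x m * `|F x m| - F y m * `|F y m| | <=
      2^-1 * (2 - 2 * G x y + 2 * d ^+ 2 * (1 + 1)).
    apply: (@le_trans _ _ (2^-1 * (\sum_(m < n) (F x m - F y m) ^+ 2 +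
        2 * d ^+ 2 * (\sum_(m < n) F x m ^+ 2 + \sum_(m < n) F y m ^+ 2)))); last first.
      by rewrite ler_pM2l ?invr_gt0 // lerD // ler_pM2l ?lerD // mulr_gt0 // exprn_gt0.
    rewrite -big_split /= !mulr_sumr -big_split /= mulr_sumr; apply: ler_sum => m _.
    by rewrite mulrCA ler_pM2l ?invr_gt0 //; exact: signed_sqr_le.
  rewrite -(ler_pM2l (_ : 0 < 2 * d)) ?mulr_gt0 // (le_trans h) //.
  have := expR_ge1Dx (- (d ^+ 2 * sqdist x y)); rewrite -/(G x y) => hG; nra.
- pose M := maxn (N x) (N y); exists M.
  apply: (@le_trans _ _
    (\sum_(m < M) (2^-1 * (2^-1 * (F x m - F y m) ^+ 2) - (b m)^-1))); last first.
    apply: ler_sum => m _; rewrite /gap -/(b m) ler_pdivlMr // mulrBl mulVf ?gt_eqF //.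
    rewrite [_ * b m]mulrC; have /andP[+ _] := aq x y m; rewrite fd; apply: le_trans.
    by rewrite lerD2r ler_pM2l // ler_pM2l ?invr_gt0 //; exact: signed_sqr_ge.
  rewrite sumrB lerB // -!mulr_sumr dF ?leq_maxl ?leq_maxr //.
  have : G x y <= 4^-1.
    rewrite /G expRN lef_pV2 ?posrE ?expR_gt0 //.
    have := expR_ge1Dx (d ^+ 2 * sqdist x y); lra.
  lra.
Qed.

Lemma gap_ge0 b p q : 0 <= gap b p q.
Proof. by rewrite /gap divr_ge0. Qed.

(** The superposition of the scales [d 2^-k], in which the rounding precision grows
    with [k] so that both the distances of close points and the rounding errors form
    geometric series.  For distant points each scale [k < K'] contributes at least
    1/4, whence the choice of [K'] above [4 M]. *)
Lemma thresholds (c eps : R) : 0 <= c -> 0 < eps ->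
  exists (b : nat -> nat) (a : nat -> V -> nat),
  [/\ forall j, (0 < b j)%N,
      forall j x, (a j x <= b j)%N,
      forall x y, sqdist x y <= c ->
        forall n, \sum_(j < n) gap (b j) (a j x) (a j y) <= eps
    & forall M, exists r, forall x y, r <= sqdist x y ->
        exists n, M <= \sum_(j < n) gap (b j) (a j x) (a j y)].
Proof.
move=> c0 eps0; pose C := ((Num.truncn (8 / eps)).+1 + 16)%N.
have C0 : 0 < C%:R :> R by rewrite ltr0n.
have Ceps : 4 / C%:R <= eps / 2.
  have : 8 / eps <= C%:R.
    by rewrite /C natrD (le_trans (ltW (truncnS_gt _))) // lerDl.
  by rewrite !ler_pdivrMr //; lra.
have C16 : 2 / C%:R <= 8^-1 :> R.
  have : (16%:R : R) <= C%:R by rewrite ler_nat leq_addl.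
  by rewrite ler_pdivrMr //; lra.
(* With these choices close points are at distance at most [eps / 4 + 2 / C] times
   [2^-k] at scale [k], where [2 / C <= eps / 4]. *)
pose d : R := eps / (4 * (c / 2 + 1)).
have c1 : 0 < c / 2 + 1 by rewrite ltr_pwDr // divr_ge0.
have d0 : 0 < d by rewrite divr_gt0 // mulr_gt0.
pose h k : R := 2^-1 ^+ k.
have h0 k : 0 < h k by rewrite exprn_gt0 // invr_gt0.
pose b k m := (C * 2 ^ k * 2 ^ m)%N.
have b0 k m : (0 < b k m)%N by rewrite !muln_gt0 !expn_gt0.
have Bk0 k : (0 < C * 2 ^ k)%N by rewrite muln_gt0 expn_gt0.
have /choice[a sa] k := @scale_thresholds (d * h k) (C * 2 ^ k)
  (mulr_gt0 d0 (h0 k)) (Bk0 k).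
have BE k : 2 / (C * 2 ^ k)%:R = 2 / C%:R * h k.
  by rewrite natrM natrX invfM mulrA /h exprVn.
pose g x y (i : nat * nat) := gap (b i.1 i.2) (a i.1 i.2 x) (a i.1 i.2 y).
exists (fun j => oapp (fun i => b i.1 i.2) 1%N (pickle_inv j)).
exists (fun j x => oapp (fun i => a i.1 i.2 x) 0%N (pickle_inv j)).
have gE x y j : gap (oapp (fun i => b i.1 i.2) 1%N (pickle_inv j))
    (oapp (fun i => a i.1 i.2 x) 0%N (pickle_inv j))
    (oapp (fun i => a i.1 i.2 y) 0%N (pickle_inv j)) = oapp (g x y) 0 (pickle_inv j).
  by case: (pickle_inv j) => //=; rewrite /gap subrr normr0 mul0r.
split=> [j|j x|x y xy n|M].
- by case: (pickle_inv j) => //= i; exact: b0.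
- by case: (pickle_inv j) => //= i; have [] := sa i.1.
- under eq_bigr do rewrite gE; apply: sum_pickle_inv_le => [i|K' M]; first exact: gap_ge0.
  apply: (@le_trans _ _ (\sum_(k < K') (eps / 4 + 2 / C%:R) * h k)).
    apply: ler_sum => k _; have [_ /(_ x y M) /le_trans + _] := sa k; apply.
    rewrite BE [leRHS]mulrDl; apply: lerD => //; rewrite mulrAC ler_pM2r //.
    apply: (@le_trans _ _ (d * (c / 2 + 1))); last first.
      by rewrite /d invfM mulrA mulfVK ?gt_eqF.
    by rewrite ler_pM2l // lerD2r ler_pM2r // invr_gt0.
  rewrite -mulr_sumr (le_trans (ler_wpM2l _ (sum_half_le _))) //.
    by rewrite addr_ge0 // ?divr_ge0 // ltW.
  by rewrite mulrDl; lra.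
- have [K' MK] : exists K' : nat, 4 * M <= K'%:R.
    by exists (Num.truncn (4 * M)).+1; rewrite ltW // truncnS_gt.
  exists (3 / (d * h K') ^+ 2) => x y xy.
  have far k : exists m, (k < K')%N -> 4^-1 <= \sum_(i < m) g x y (k, i : nat).
    have [kK|] := ltnP k K'; last by exists 0%N.
    have [_ _ /(_ x y)[|m hm]] := sa k; last first.
      exists m => _; apply: le_trans hm; rewrite BE.
      have : 2 / C%:R * h k <= 8^-1.
        rewrite (le_trans _ C16) // ler_piMr ?divr_ge0 // exprn_ile1 ?invr_ge0 //.
        by rewrite invf_le1 // ler1n.
      lra.
    have hk : 0 < (d * h K') ^+ 2 by rewrite exprn_gt0 // mulr_gt0.
    have : 3 <= (d * h K') ^+ 2 * sqdist x y by rewrite mulrC -ler_pdivrMr.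
    move=> /le_trans; apply; rewrite ler_wpM2r //.
      by apply: le_trans xy; rewrite divr_ge0 // ltW.
    rewrite ler_sqr ?nnegrE ?(ltW (mulr_gt0 d0 (h0 _))) // ler_pM2l // /h.
    by rewrite ler_wiXn2l ?invr_ge0 ?invf_le1 ?ler1n // ltnW.
  have [m mP] := choice far; pose mx := \max_(k < K') m k.
  have [n hn] := @sum_pickle_inv_ge (g x y) K' mx (fun i => gap_ge0 _ _ _).
  exists n; under eq_bigr do rewrite gE; apply: le_trans hn.
  apply: (@le_trans _ _ (\sum_(k < K') 4^-1)).
    by rewrite sumr_const card_ord -mulr_natl; lra.
  apply: ler_sum => k _; apply: le_trans (mP k (ltn_ord k)) _.
  apply: (@ler_sum_widen (fun i => g x y (k : nat, i))) => [i|]; first exact: gap_ge0.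
  exact: (leq_bigmax (F := fun k : 'I_K' => m k)).
Qed.

End Thresholds.
End EllOne.

(** * Percolation from thresholds *)

Section ConfigMeasurable.
Variables (V : Type) (E : set (set V)).
Implicit Types (w : bond_config E) (s : seq (E * bool)).

Definition cylinder s : set (bond_config E) :=
  [set w | forall ec, ec \in s -> w ec.1 = ec.2].

(** The filter generated by the cylinders around [w] converges to [w] coordinatewise,
    hence in the product topology, so it contains every neighbourhood of [w]. *)
Lemma open_cylinder (O : set (bond_config E)) w : open O -> O w ->
  exists2 s, cylinder s w & cylinder s `<=` O.
Proof.
pose F : set_system (bond_config E) :=
  [set A | exists2 s, cylinder s w & cylinder s `<=` A].
have FF : Filter F.
  split=> [|A B [s sw sA] [t tw tB]|A B AB [s sw sA]].
  - by exists [::].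
  - exists (s ++ t) => [ec|w' st]; first by rewrite mem_cat => /orP[/sw|/tw].
    split; first by apply: sA => ec ecs; apply: st; rewrite mem_cat ecs.
    by apply: tB => ec ect; apply: st; rewrite mem_cat ect orbT.
  - by exists s => // w' /sA /AB.
have cF : F --> w.
  apply/cvg_sup => e A; rewrite nbhsE => -[B [[C oC CB] Bw] BA].
  exists [:: (e, w e)] => [ec|w' /(_ _ (mem_head _ _)) /= w'e].
    by rewrite inE => /eqP ->.
  by apply: BA; rewrite -CB /preimage /= w'e -[C _]/((@^~ e @^-1` C) w) CB.
by move=> oO Ow; apply: cF; exact: open_nbhs_nbhs.
Qed.

(** With countably many edges there are countably many cylinders, so an open set is a
    countable union of them. *)
Lemma measurable_config d (T : measurableType d) (X : T -> bond_config E) :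
  countable E -> (forall e, measurable [set t | X t e]) ->
  measurable_fun setT (X : T -> borel_config E).
Proof.
move=> cE mX; apply: (@measurability _ _ T (borel_config E) setT X (@open (bond_config E))) => //.
move=> _ [B oB <-]; rewrite setTI.
have mcyl s : measurable (X @^-1` cylinder s).
  elim: s => [|[e c] s IH].
    by rewrite (_ : _ @^-1` _ = setT) //; apply/seteqP; split=> t // _ ec.
  have mc : measurable [set t | X t e = c].
    case: c; first exact: mX.
    rewrite (_ : [set t | _] = ~` [set t | X t e]); first exact: measurableC.
    by apply/seteqP; split=> t /=; [move=> ->|case: (X t e)].
  rewrite (_ : _ @^-1` _ = [set t | X t e = c] `&` (X @^-1` cylinder s)).
    exact: measurableI.
  apply/seteqP; split=> t /= => [Xt|[te Xt] ec].
    split; first exact: (Xt (e, c) (mem_head _ _)).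
    by move=> ec ecs; apply: Xt; rewrite inE ecs orbT.
  by rewrite inE => /orP[/eqP -> //|]; exact: Xt.
rewrite (_ : X @^-1` B = \bigcup_(s : seq (E * bool))
    (if `[< cylinder s `<=` B >] then X @^-1` cylinder s else set0)).
  apply: countable_bigcupT_measurable => [|s]; last by case: ifP.
  have /countable_injP[f finj] := cE.
  have ginj : injective (fun s : seq (E * bool) => [seq (f (val ec.1), ec.2) | ec <- s]).
    apply: inj_map => -[e c] [e' c'] /= [ee' ->]; congr pair.
    by apply: val_inj; apply: finj; rewrite ?inE //; exact: set_valP.
  apply/countable_injP.
  exists (fun s => pickle [seq (f (val ec.1), ec.2) | ec <- s]).
  by move=> s t _ _ /(pcan_inj pickleK) /ginj.
apply/seteqP; split=> [t Bt|t [s _]].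
  have [s st sB] := open_cylinder oB Bt.
  by exists s => //; rewrite asboolT.
by case: asboolP => // sB /sB.
Qed.
End ConfigMeasurable.

Section ThresholdPercolation.
Variables (R : realType) (V : Type) (b : nat -> nat) (a : nat -> V -> nat).
Hypotheses (b_gt0 : forall j, (0 < b j)%N) (a_le : forall j x, (a j x <= b j)%N).
Local Notation P := (uniform01 R).

Lemma gap_le1 j x y : gap R (b j) (a j x) (a j y) <= 1.
Proof.
rewrite /gap ler_pdivrMr ?ltr0n // mul1r.
have := a_le j x; have := a_le j y; rewrite -!(ler_nat R) => ? ?.
rewrite ler_norml; have := ler0n R (a j x); have := ler0n R (a j y) => ? ?.
by apply/andP; split; lra.
Qed.

(** The residues that do not separate [p] and [q] lie below both or above both. *)
Lemma count_agree (c p q : nat) : (0 < c)%N -> (p <= c)%N -> (q <= c)%N ->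
  (\sum_(r < c) ((r < p) == (r < q)))%N%:R / c%:R = 1 - gap R c p q.
Proof.
move=> c0; wlog pq : p q / (p <= q)%N.
  move=> H pc qc; have [pq|/ltnW qp] := leqP p q; first exact: H.
  have := H _ _ qp qc pc; rewrite /gap distrC => <-.
  by congr (_%:R / _); apply: eq_bigr => r _; rewrite eq_sym.
move=> pc qc.
have E : (\sum_(r < c) ((r < p) == (r < q)) = p + (c - q))%N.
  rewrite -(big_mkord xpredT (fun r => nat_of_bool ((r < p) == (r < q))%N)).
  rewrite (big_cat_nat _ (n := q)) //= (big_cat_nat _ (n := p)) //= -addnA.
  rewrite (eq_big_nat _ _ (F2 := fun=> 1%N)); last first.
    by move=> r /andP[_ rp]; rewrite rp (leq_trans rp pq).
  rewrite [X in (_ + (X + _))%N](eq_big_nat _ _ (F2 := fun=> 0%N)); last first.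
    by move=> r /andP[pr rq]; rewrite rq ltnNge pr.
  rewrite [X in (_ + (_ + X))%N](eq_big_nat _ _ (F2 := fun=> 1%N)); last first.
    by move=> r /andP[qr rc]; rewrite !ltnNge qr (leq_trans pq qr).
  by rewrite !sum_nat_const_nat !muln1 muln0 subn0.
rewrite E natrD natrB // /gap ler0_norm ?subr_le0 ?ler_nat //.
by field; rewrite pnatr_eq0 -lt0n.
Qed.

Definition bit j x (u : R) : bool := (digit b j u < a j x)%N.

Definition agree x y : set R := [set u | forall j, bit j x u = bit j y u].

Definition agree_upto n x y : set R :=
  [set u | forall j, (j < n)%N -> bit j x u = bit j y u].

Lemma agreeE x y : agree x y = \bigcap_n agree_upto n x y.
Proof.
apply/seteqP; split=> [u uxy n _ j _|u uxy j]; first exact: uxy.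
exact: (uxy j.+1 I j).
Qed.

Lemma measurable_agree_upto n x y : measurable (agree_upto n x y).
Proof.
rewrite (_ : agree_upto n x y = \bigcap_(j in [set j | (j < n)%N])
  [set u | (digit b j u < a j x)%N == (digit b j u < a j y)%N]); last first.
  by apply/seteqP; split=> u uxy j jn; [apply/eqP; exact: uxy|have /eqP := uxy j jn].
apply: bigcap_measurableType => j _.
exact: (measurable_digit b_gt0 j (fun r => (r < a j x)%N == (r < a j y)%N)).
Qed.

Lemma measurable_agree x y : measurable (agree x y).
Proof.
rewrite agreeE; apply: bigcap_measurableType => n _; exact: measurable_agree_upto.
Qed.

Lemma prob_agree_upto n x y :
  P (agree_upto n x y) = (\prod_(j < n) (1 - gap R (b j) (a j x) (a j y)))%:E.
Proof.
under eq_bigr => j _ do rewrite -(count_agree (b_gt0 j) (a_le j x) (a_le j y)).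
rewrite -(prob_digits R b_gt0 (fun j r => (r < a j x)%N == (r < a j y)%N)).
congr (P _); apply/seteqP.
by split=> u uxy j jn; [apply/eqP; exact: uxy|have /eqP := uxy j jn].
Qed.

Lemma prob_agree_le n x y :
  (P (agree x y) <= (expR (- \sum_(j < n) gap R (b j) (a j x) (a j y)))%:E)%E.
Proof.
apply: (@le_trans _ _ (P (agree_upto n x y))).
  rewrite le_measure ?inE //; [exact: measurable_agree|exact: measurable_agree_upto|].
  by move=> u uxy j _; exact: uxy.
rewrite prob_agree_upto lee_fin -sumrN expR_sum; apply: ler_prod => j _.
by rewrite subr_ge0 gap_le1 expR_ge1Dx.
Qed.

(** By continuity from above it is enough to bound finite products, which satisfy
    Bernoulli's inequality. *)
Lemma prob_agree_ge (eps : R) x y :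
  (forall n, \sum_(j < n) gap R (b j) (a j x) (a j y) <= eps) ->
  ((1 - eps)%:E <= P (agree x y))%E.
Proof.
move=> heps.
have h : (P (agree_upto 0 x y) < +oo)%E by rewrite prob_agree_upto ltry.
have c : P (agree_upto n x y) @[n --> \oo] --> P (agree x y).
  rewrite agreeE; apply: (@nonincreasing_cvg_mu _ _ _ P (fun n => agree_upto n x y)).
  - exact: h.
  - by move=> n; exact: measurable_agree_upto.
  - by rewrite -agreeE; exact: measurable_agree.
  - by move=> m n mn; apply/subsetPset => u uxy j jm; apply: uxy; exact: leq_trans mn.
apply: (cvge_to_ge c); apply: nearW => n; rewrite prob_agree_upto lee_fin.
apply: (@le_trans _ _ (1 - \sum_(j < n) gap R (b j) (a j x) (a j y))).
  by rewrite lerD2l lerN2.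
elim: n => [|n IH]; first by rewrite !big_ord0 subr0.
rewrite !big_ord_recr /= mulrBr mulr1 opprD addrA lerD // lerN2.
rewrite ler_piMl ?gap_ge0 // prodr_ile1 // => j _.
by rewrite subr_ge0 gap_le1 gerBl gap_ge0.
Qed.

Section Config.
Variable E : set (set V).
Hypotheses (E_countable : countable E)
  (E_pair : forall e : E, exists x y, val e = [set x; y]).

(** Quantifying over the elements of the edge avoids ordering its two ends. *)
Definition agree_config (u : R) : bond_config E :=
  fun e => `[< forall x y, val e x -> val e y -> agree x y u >].

Lemma agree_configE (e : E) x y : val e = [set x; y] ->
  [set u | agree_config u e] = agree x y.
Proof.
move=> exy; apply/seteqP; split=> u.
  by move=> /asboolP; apply; rewrite exy; [left|right].
by move=> uxy; apply/asboolP; rewrite exy => x' y' [->|->] [->|->] j //; rewrite uxy.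
Qed.

Lemma measurable_agree_config :
  measurable_fun setT (agree_config : measurableTypeR R -> borel_config E).
Proof.
apply: measurable_config => // e; have [x [y exy]] := E_pair e.
by rewrite (agree_configE exy); exact: measurable_agree.
Qed.

HB.instance Definition _ := isMeasurableFun.Build _ _ _ (borel_config E)
  (agree_config : measurableTypeR R -> borel_config E) measurable_agree_config.

Lemma connected_agree u x y : connected_in (agree_config u) x y -> agree x y u.
Proof.
move=> [p]; elim: p x => [|z p IH] x [] /=; first by move=> _ ->.
move=> /andP[/asboolP[e /asboolP ue exz] pz] pl j.
by rewrite (ue x z) ?exz; [exact: (IH z (conj pz pl))|left|right].
Qed.

Lemma percolation_of_thresholds : exists Q : percolation R E,
  (forall (e : E) x y (eps : R), val e = [set x; y] ->
    (forall n, \sum_(j < n) gap R (b j) (a j x) (a j y) <= eps) ->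
    ((1 - eps)%:E <= Q [set w : bond_config E | w e])%E) /\
  (forall x y n, two_point Q x y <= expR (- \sum_(j < n) gap R (b j) (a j x) (a j y))).
Proof.
exists (distribution P (agree_config : {mfun measurableTypeR R >-> borel_config E})); split.
  move=> e x y eps exy heps; rewrite /distribution /pushforward /=.
  by rewrite [_ @^-1` _](agree_configE exy) prob_agree_ge.
move=> x y n; rewrite /two_point /distribution /pushforward /=.
set A := _ @^-1` _.
have mA : measurable (A : set (measurableTypeR R)).
  by rewrite -[A]setTI; apply: measurable_agree_config => //; exact: measurable_connected_in.
rewrite -lee_fin fineK; last exact: fin_num_measure.
apply: le_trans (prob_agree_le n x y).
rewrite le_measure ?inE //; first exact: measurable_agree.
by move=> u; exact: connected_agree.
Qed.

End Config.
End ThresholdPercolation.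

(** * Positive semidefinite kernels from random equivalence relations *)

Section TwoPoint.
Variable R : realType.

(** The form is the sum over the classes of the squared total weight.  Classes are
    labelled by the position of their first representative in the list. *)
Lemma psd_equivalence (T : eqType) (r : rel T) :
  reflexive r -> symmetric r -> transitive r -> psd (fun x y => (r x y)%:R : R).
Proof.
move=> rr rs rt; split=> [x y|s]; first by rewrite rs.
pose c x := find (r x) [seq q.2 | q <- s].
have cs p : p \in s -> (c p.2 < size s)%N.
  move=> ps; rewrite -(size_map (fun q : R * T => q.2)) -has_find; apply/hasP.
  by exists p.2 => //; exact: map_f.
have rE p q : p \in s -> q \in s ->
    (r p.2 q.2)%:R = \sum_(k < size s) (c p.2 == k)%:R * (c q.2 == k)%:R :> R.
  move=> ps qs; rewrite (bigD1 (Ordinal (cs _ ps))) //= eqxx mul1r big1 ?addr0.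
    congr (_%:R); congr nat_of_bool; apply/idP/eqP => [pq|qp].
      apply: eq_find => z; apply/idP/idP; first exact: rt pq.
      by apply: rt; rewrite rs.
    have hp : r p.2 (nth p.2 [seq q.2 | q <- s] (c p.2)).
      by apply: nth_find; rewrite has_find size_map; exact: cs.
    have hq : r q.2 (nth p.2 [seq q.2 | q <- s] (c q.2)).
      by apply: nth_find; rewrite has_find size_map; exact: cs.
    by apply: (rt _ _ _ hp); rewrite -qp rs.
  move=> k kp; rewrite (_ : (c p.2 == k) = false) ?mul0r //.
  by apply/negbTE; move: kp; apply: contra => /eqP ck; apply/eqP/val_inj.
rewrite (_ : quad _ s = \sum_(k < size s) (\sum_(p <- s) p.1 * (c p.2 == k)%:R) ^+ 2).
  by apply: sumr_ge0 => k _; exact: sqr_ge0.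
rewrite /quad; under [RHS]eq_bigr do rewrite expr2 big_distrlr /=.
rewrite [RHS]exchange_big; apply: eq_big_seq => p ps.
rewrite [RHS]exchange_big; apply: eq_big_seq => q qs.
by rewrite rE // mulr_sumr; apply: eq_bigr => k _; rewrite mulrACA.
Qed.

(** Mixtures of psd kernels are psd: integrate the quadratic form. *)
Lemma psd_prob d (O : measurableType d) (Q : probability O R) (T : eqType)
    (A : T -> T -> set O) : (forall x y, measurable (A x y)) ->
  (forall w, psd (fun x y => \1_(A x y) w : R)) ->
  psd (fun x y => fine (Q (A x y))).
Proof.
move=> mA pA; split=> [x y|s].
  have sA x' y' w : A x' y' w -> A y' x' w.
    move=> Aw; have := (pA w).1 x' y'; rewrite !indicE (mem_set Aw).
    by case: (boolP (w \in A y' x')) => [/set_mem //|_ /eqP]; rewrite oner_eq0.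
  by congr (fine (Q _)); apply/seteqP; split=> w; exact: sA.
have hi x y c : Q.-integrable setT (fun w => c%:E * (\1_(A x y) w)%:E)%E.
  by apply: integrableZl => //; exact: integrable_indic.
rewrite -lee_fin (_ : (quad _ s)%:E =
  (\int[Q]_w \sum_(p <- s) \sum_(q <- s) ((p.1 * q.1)%:E * (\1_(A p.2 q.2) w)%:E))%E).
  apply: integral_ge0 => w _; have := (pA w).2 s.
  rewrite -lee_fin /quad -sumEFin => /le_trans; apply; rewrite le_eqVlt; apply/orP; left.
  by apply/eqP; apply: eq_bigr => p _; rewrite -sumEFin; apply: eq_bigr.
rewrite integral_sum //; last by move=> p; apply: integrable_sum.
rewrite /quad -sumEFin; apply: eq_bigr => p _.
rewrite integral_sum // -sumEFin; apply: eq_bigr => q _.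
rewrite integralZl //; last exact: integrable_indic.
by rewrite integral_indic // setIT EFinM fineK // fin_num_measure.
Qed.

End TwoPoint.

(** * Clusters and coarse embeddings *)

Section Clusters.
Variables (R : realType) (V : Type) (E : set (set V)).
Implicit Types (w : bond_config E) (u v : V).

Lemma connected_refl w u : connected_in w u u.
Proof. by exists [::]. Qed.

Lemma connected_trans w u v x :
  connected_in w u v -> connected_in w v x -> connected_in w u x.
Proof.
move=> [p [up <-]] [q [vq <-]]; exists (p ++ q); split; last by rewrite last_cat.
by rewrite cat_path up vq.
Qed.

Lemma connected_sym w u v : connected_in w u v -> connected_in w v u.
Proof.
move=> [p]; elim: p u => [|x p IH] u [] /=; first by move=> _ ->; exact: connected_refl.
move=> /andP[ux xp] pv; apply: connected_trans (IH x (conj xp pv)) _.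
by exists [:: u]; split => //=; rewrite andbT /adjacent setUC.
Qed.

Lemma connected_edge w (e : E) u v : val e = [set u; v] -> w e -> connected_in w u v.
Proof.
move=> euv we; exists [:: v]; split => //=; rewrite andbT.
by apply/asboolP; exists e.
Qed.

Variable Q : percolation R E.
Local Notation tau := (two_point Q).

Lemma psd_two_point (T : eqType) (h : T -> V) : psd (fun x y => tau (h x) (h y)).
Proof.
apply: (@psd_prob _ _ _ Q _ (fun x y => [set w : bond_config E | connected_in w (h x) (h y)])).
  by move=> x y; exact: measurable_connected_in.
move=> w; have := @psd_equivalence R T (fun x y => `[< connected_in w (h x) (h y) >]).
case.
- by move=> x; apply/asboolP; exact: connected_refl.
- by move=> x y; apply/asboolP/asboolP; exact: connected_sym.
- by move=> y x z /asboolP xy /asboolP yz; apply/asboolP; exact: connected_trans yz.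
by move=> sK nK; split.
Qed.

Let mconn u v : measurable ([set w | connected_in w u v] : set (borel_config E)) :=
  @measurable_connected_in V E u v.

Lemma two_point_fineK u v : (tau u v)%:E = Q [set w | connected_in w u v].
Proof. by rewrite /two_point fineK // fin_num_measure. Qed.

Lemma two_point_ge0 u v : 0 <= tau u v.
Proof. by rewrite -lee_fin two_point_fineK. Qed.

Lemma two_point_le1 u v : tau u v <= 1.
Proof. by rewrite -lee_fin two_point_fineK probability_le1. Qed.

Lemma two_point_refl u : tau u u = 1.
Proof.
apply: EFin_inj; rewrite two_point_fineK.
rewrite (_ : [set w | _] = setT) ?probability_setT //.
by apply/seteqP; split=> // w _; exact: connected_refl.
Qed.

(** A union bound: [u] and [x] are disconnected only if [u] and [v], or [v] and [x],
    are. *)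
Lemma disconnection_triangle u v x :
  1 - tau u x <= (1 - tau u v) + (1 - tau v x).
Proof.
have cE y z : (1 - tau y z)%:E = Q (~` [set w | connected_in w y z]).
  by rewrite probability_setC // EFinB two_point_fineK.
rewrite -lee_fin [leRHS]EFinD !cE.
apply: (@le_trans _ _ (Q (~` [set w | connected_in w u v] `|` ~` [set w | connected_in w v x]))).
  rewrite le_measure ?inE //; first exact: measurableC.
    by apply: measurableU; exact: measurableC.
  move=> w ux; apply: contrapT => /not_orP[/contrapT uv /contrapT vx].
  exact/ux/connected_trans/vx.
by apply: measureU2; exact: measurableC.
Qed.

Lemma two_point_edge (e : E) u v (p : R) : val e = [set u; v] ->
  (p%:E < Q [set w : bond_config E | w e])%E -> p <= tau u v.
Proof.
move=> euv pe; rewrite -lee_fin two_point_fineK; apply: le_trans (ltW pe) _.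
rewrite le_measure ?inE //; last by move=> w; exact: connected_edge.
by apply: sub_sigma_algebra; exact: open_edge.
Qed.

End Clusters.

Section Coarse.
Variables (R : realType) (X Y : Type) (dX : X -> X -> R) (dY : Y -> Y -> R) (f : X -> Y).

Lemma coarse_embedding_near c : coarse_embedding dX dY f ->
  (forall u v, 0 <= dX u v) -> exists M, forall u v, dX u v <= c -> dY (f u) (f v) <= M.
Proof.
move=> [rho1 [rho2 [rho0 _ r2 _ r12]]] dX0; exists (rho2 (Num.max 0 c)) => u v uv.
have /andP[_ h] := r12 u v; apply: (le_trans h); apply: r2.
- by rewrite in_itv /= andbT.
- by rewrite in_itv /= andbT le_max lexx.
- by rewrite le_max uv orbT.
Qed.

Lemma coarse_embedding_far M : coarse_embedding dX dY f ->
  exists r, forall u v, r < dX u v -> M <= dY (f u) (f v).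
Proof.
move=> [rho1 [rho2 [_ _ _ /cvgryPge/(_ M) [r [_ hr]] r12]]]; exists r => u v uv.
have /andP[h _] := r12 u v; apply: le_trans h; exact: hr.
Qed.

(** The lower control function is the infimum of [dY (f u) (f v)] plus the amount by
    which [dX u v] falls short of [t].  Taking the infimum over the pairs at distance
    at least [t] would fail when the distances are bounded, as it is then over an
    empty set for large [t]. *)
Lemma coarse_embedding_intro (x0 : X) (rho2 : R -> R) :
  (forall u v, 0 <= dX u v) -> (forall u v, 0 <= dY u v) ->
  (forall t, 0 <= t -> 0 <= rho2 t) -> {in `[0, +oo[ &, {homo rho2 : s t / s <= t}} ->
  (forall u v, dY (f u) (f v) <= rho2 (dX u v)) ->
  (forall M, exists r, forall u v, r < dX u v -> M <= dY (f u) (f v)) ->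
  coarse_embedding dX dY f.
Proof.
move=> dX0 dY0 rho0 rho_homo frho far.
pose A t := [set dY (f uv.1) (f uv.2) + Num.max 0 (t - dX uv.1 uv.2) | uv in [set: X * X]].
have A0 t : A t !=set0 by exists (dY (f x0) (f x0) + Num.max 0 (t - dX x0 x0)), (x0, x0).
have lbA t : has_lbound (A t).
  by exists 0 => _ [uv _ <-]; rewrite addr_ge0 // le_max lexx.
exists (fun t => inf (A t)), rho2; split => //.
- move=> t t0; split; last exact: rho0.
  by apply: lb_le_inf => // _ [uv _ <-]; rewrite addr_ge0 // le_max lexx.
- move=> s t _ _ st; apply: lb_le_inf => // _ [uv _ <-].
  apply: (@le_trans _ _ (dY (f uv.1) (f uv.2) + Num.max 0 (s - dX uv.1 uv.2))).
    by apply: ge_inf => //; exists uv.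
  rewrite lerD2l ge_max le_max lexx /= le_max; apply/orP; right.
  by rewrite lerD2r.
- apply/cvgryPge => M; have [r hr] := far M.
  exists (Num.max 0 r + M); split=> [|t rMt]; first exact: num_real.
  apply: lb_le_inf => // _ [[u v] _ <-] /=.
  have [rd|dr] := ltP r (dX u v).
    by rewrite (le_trans (hr _ _ rd)) // lerDl le_max lexx.
  apply: (@le_trans _ _ (t - dX u v)); last first.
    by apply: (@le_trans _ _ (Num.max 0 (t - dX u v))); rewrite ?lerDr // le_max lexx orbT.
  rewrite lerBrDl; apply: le_trans (ltW rMt); rewrite lerD2r.
  by rewrite le_max dr orbT.
- move=> u v; rewrite frho andbT; apply: ge_inf => //.
  by exists (u, v) => //=; rewrite subrr maxxx addr0.
Qed.

End Coarse.

(** * Word metrics *)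

Section Words.
Variables (R : realType) (G : groupType).
Implicit Types (S : set G) (g h : G).

Lemma word_dist_le S g h s :
  word_for S (g^-1 * h)%g s -> word_dist R S g h <= (size s)%:R.
Proof.
move=> sw; apply: ge_inf; last by exists s.
by exists 0 => _ [t _ <-]; rewrite ler0n.
Qed.

Lemma word_dist_word S g h : finite_generating S ->
  exists2 s, word_for S (g^-1 * h)%g s & word_dist R S g h = (size s)%:R.
Proof.
move=> [_ gS]; pose P n := `[< exists2 s, word_for S (g^-1 * h)%g s & size s = n >].
have exP : exists n, P n.
  by have [s sw] := gS (g^-1 * h)%g; exists (size s); apply/asboolP; exists s.
case: (ex_minnP exP) => n /asboolP[s sw sn] nmin; exists s => //.
apply/eqP; rewrite eq_le word_dist_le //=; apply: lb_le_inf; first by exists (size s)%:R, s.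
move=> _ [t tw <-]; rewrite ler_nat sn; apply: nmin.
by apply/asboolP; exists t.
Qed.

Lemma word_dist_ge0 S g h : finite_generating S -> 0 <= word_dist R S g h.
Proof. by move=> /(word_dist_word g h)[s _ ->]. Qed.

Lemma word_for_cat S g h s t :
  word_for S g s -> word_for S h t -> word_for S (g * h)%g (s ++ t).
Proof.
move=> [Ss sg] [St th]; split; last by rewrite big_cat /= sg th.
by move=> x; rewrite mem_cat => /orP[/Ss|/St].
Qed.

Lemma finite_bounded (T : choiceType) (A : set T) (f : T -> nat) : finite_set A ->
  exists L, forall x, A x -> (f x <= L)%N.
Proof.
move=> /finite_seqP[z ->]; exists (\max_(x <- z) f x) => x xz.
exact: (leq_bigmax_seq (F := f)).
Qed.

(** Each letter, of which there are finitely many, is replaced by a word over [S']. *)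
Lemma word_subst S S' : finite_generating S -> finite_generating S' ->
  exists L, forall g s, word_for S g s ->
    exists2 t, word_for S' g t & (size t <= L * size s)%N.
Proof.
move=> [fS _] [_ gS']; have /choice[f fw] := gS'.
have [L1 h1] := finite_bounded (fun x => size (f x)) fS.
have [L2 h2] := finite_bounded (fun x => size (f x^-1%g)) fS.
exists (L1 + L2)%N => g s; elim: s g => [|x s IH] g [sS sg].
  by exists [::] => //; split=> //; rewrite -sg big_nil.
have [|t tw ts] := IH (\prod_(y <- s) y)%g.
  by split=> // y ys; apply: sS; rewrite inE ys orbT.
exists (f x ++ t); first by rewrite -sg big_cons; exact: word_for_cat.
rewrite size_cat /= mulnS leq_add //.
have [Sx|Sx] := sS x (mem_head _ _); first by rewrite (leq_trans (h1 _ Sx)) // leq_addr.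
by have := h2 _ Sx; rewrite invgK => /leq_trans; apply; rewrite leq_addl.
Qed.

Lemma finite_generating_enum S : finite_generating S ->
  exists e : nat -> G, forall x, exists n, e n = x.
Proof.
move=> [/finite_seqP[z ->] gX].
pose letter (ib : nat * bool) := (if ib.2 then nth 1 z ib.1 else (nth 1 z ib.1)^-1)%g.
pose e n : G := if unpickle n is Some l
  then (\prod_(ib <- (l : seq (nat * bool))) letter ib)%g else 1%g.
exists e => g; suff [l lg] : exists l, (\prod_(ib <- l) letter ib)%g = g.
  by exists (pickle l); rewrite /e pickleK.
have [s [sS <-]] := gX g; elim: s sS {g} => [|x s IH] sS; first by exists [::]; rewrite !big_nil.
have [|l lE] := IH; first by move=> y ys; apply: sS; rewrite inE ys orbT.
have [xz|xz] := sS x (mem_head _ _).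
  by exists ((index x z, true) :: l); rewrite !big_cons lE /letter /= nth_index.
by exists ((index x^-1%g z, false) :: l); rewrite !big_cons lE /letter /= nth_index // invgK.
Qed.

Lemma cayley_edges_countable S (e : nat -> G) : (forall x, exists n, e n = x) ->
  countable (cayley_edges S).
Proof.
move=> eG; pose f (ij : nat * nat) := [set e ij.1; e ij.2].
apply: (@sub_countable _ _ _ (range f)); last first.
  by apply: (@sub_countable _ _ _ [set: nat * nat]) => //; exact: card_image_le.
apply: subset_card_le => _ [g [s [_ ->]]].
by have [i <-] := eG g; have [j <-] := eG (e i * s)%g; exists (i, j).
Qed.

Lemma cayley_generating_exists : finitely_generated G ->
  exists S : set G, cayley_generating S.
Proof.
move=> [S [fS gS]]; exists (S `|` [set x^-1%g | x in S]); split; last first.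
  by move=> x [Sx|[y Sy <-]]; [right; exists x|left; rewrite invgK].
split; first by rewrite finite_setU; split => //; exact: finite_image.
move=> g; have [s [sS sg]] := gS g; exists s; split=> // x /sS[Sx|Sx]; left; first by left.
by right; exists x^-1%g; rewrite ?invgK.
Qed.

End Words.

(** * A Hilbert space embedding from percolations *)

Section Vanishing.
Variables (R : realType) (V : Type) (E : set (set V)) (Q : percolation R E).

(** The supremum is over a bounded set, and is 0 when this set is empty. *)
Lemma vanishes_at_infinityP : vanishes_at_infinity E (two_point Q) <->
  forall eps : R, 0 < eps -> exists r : R, forall u v,
    r < graph_dist R E u v -> two_point Q u v <= eps.
Proof.
pose A r := [set two_point Q uv.1 uv.2 |
  uv in [set uv : V * V | r < graph_dist R E uv.1 uv.2]].
have ubA r : has_ubound (A r) by exists 1 => _ [uv _ <-]; exact: two_point_le1.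
split=> [/cvgrPdist_le cv eps eps0|h].
  have [r [_ hr]] := cv _ eps0; exists (r + 1) => u v uv.
  have /= := hr (r + 1) (ltr_pwDr ltr01 (lexx r)).
  rewrite sub0r normrN => /(le_trans (ler_norm _)); apply: le_trans.
  by apply: ub_le_sup; [exact: (ubA (r + 1))|exists (u, v)].
apply/cvgrPdist_le => eps eps0; have [r hr] := h _ eps0.
exists r; split=> [|t rt]; first exact: num_real.
rewrite sub0r normrN; rewrite -/(A t).
have [->|/set0P A0] := eqVneq (A t) set0; first by rewrite sup0 normr0 ltW.
rewrite ger0_norm.
  apply: ge_sup => // _ [uv uvt <-]; apply: hr; exact: lt_trans uvt.
have [_ [uv uvt _]] := A0.
by apply: (le_trans (two_point_ge0 Q uv.1 uv.2)); apply: ub_le_sup => //; exists uv.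
Qed.

End Vanishing.

Section FromPercolation.
Variables (R : realType) (G : groupType) (S : set G).
Hypotheses (cS : cayley_generating S) (pS : propertyP R (cayley_edges S)).

Let E := cayley_edges S.

(** The path spelled by the word has all its edges open except with probability at
    most the sum of the failure probabilities, by [disconnection_triangle]. *)
Lemma disconnection_word (Q : percolation R E) (eps : R) :
  (forall e : E, ((1 - eps)%:E < Q [set w : bond_config E | w e])%E) ->
  forall g h s, word_for S (g^-1 * h)%g s ->
    1 - two_point Q g h <= (size s)%:R * eps.
Proof.
move=> he g h s; elim: s g => [|x s IH] g [sS sg].
  move: sg; rewrite big_nil => /(congr1 (fun t => g * t)%g); rewrite mulg1 mulVKg => <-.
  by rewrite two_point_refl subrr mul0r.
apply: le_trans (disconnection_triangle Q g (g * x)%g h) _.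
rewrite /= -nat1r mulrDl mul1r; apply: lerD; last first.
  apply: IH; split=> [y ys|]; first by apply: sS; rewrite inE ys orbT.
  by move: sg; rewrite big_cons invgM -mulgA => <-; rewrite mulKg.
have Sx : S x by have [//|/cS.2] := sS x (mem_head _ _); rewrite invgK.
have Ee : E [set g; (g * x)%g] by exists g, x.
have := two_point_edge (e := SigSub (mem_set Ee)) (u := g) (v := (g * x)%g) erefl (he _).
lra.
Qed.

(** [psi] sums the disconnection probabilities of percolations with failure
    probabilities [2^-(n+1)]; these add up to at most 1, so that [psi] is bounded by the
    word metric and [sqrt] is an upper control function. *)
Lemma hilbert_of_percolation : coarsely_embeds_in_hilbert R G.
Proof.
have [gS symS] := cS; have [e eG] := finite_generating_enum gS.
pose h n : R := 2^-1 ^+ n.+1.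
have h0 n : 0 < h n by rewrite exprn_gt0.
have /choice[Q hQ] n : exists Q : percolation R E,
    (forall e : E, ((1 - h n)%:E < Q [set w : bond_config E | w e])%E) /\
    vanishes_at_infinity E (two_point Q).
  by apply: pS; rewrite gtrBl.
pose eta n u v := 1 - two_point (Q n) u v.
have eta0 n u v : 0 <= eta n u v by rewrite subr_ge0 two_point_le1.
have etaE u v N : \sum_(0 <= n < N) eta n u v <= word_dist R S u v.
  have [s sw ->] := word_dist_word R u v gS.
  apply: (@le_trans _ _ (\sum_(0 <= n < N) (size s)%:R * h n)).
    by apply: ler_sum => n _; exact: disconnection_word (hQ n).1 _ _ _ sw.
  rewrite -mulr_sumr ler_piMr // /h big_mkord.
  under eq_bigr do rewrite exprS.
  by rewrite -mulr_sumr; have := sum_half_le R N; lra.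
have cpsi u v : cvgn (fun N => \sum_(0 <= n < N) eta n u v).
  apply: nondecreasing_is_cvgn.
    by apply/nondecreasing_seqP => N; rewrite big_nat_recr //= lerDl.
  by exists (word_dist R S u v) => _ [N _ <-].
pose psi u v := limn (fun N => \sum_(0 <= n < N) eta n u v).
have psi_ge u v N : \sum_(0 <= n < N) eta n u v <= psi u v.
  apply: (@nondecreasing_cvgn_le _ (fun N => \sum_(0 <= n < N) eta n u v)) => //.
  by apply/nondecreasing_seqP => k; rewrite big_nat_recr //= lerDl.
have psi_le u v : psi u v <= word_dist R S u v.
  by apply: limr_le => //; apply: nearW => N; exact: etaE.
have psi_refl u : psi u u = 0.
  apply/cvg_lim => //; rewrite (_ : (fun N => _) = fun=> 0); first exact: cvg_cst.
  by apply/funext => N; rewrite big1 // => n _; rewrite /eta two_point_refl subrr.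
(* The Gromov product of the squared distance [psi], based at the identity; it is a
   limit of sums of centered two-point functions. *)
pose K u v := 2^-1 * (psi u 1%g + psi v 1%g - psi u v).
have pK : psd K.
  apply: (@psd_lim _ _ (fun N u v => 2^-1 * (\sum_(0 <= n < N)
    (two_point (Q n) u v - two_point (Q n) u 1%g - two_point (Q n) v 1%g
      + two_point (Q n) 1%g 1%g)))).
    move=> N; apply: psdZ => //; apply: psd_sum => n.
    exact: (psd_center 1%g (psd_two_point (Q n) id)).
  move=> u v; apply: cvgM; first exact: cvg_cst.
  rewrite (_ : (fun N => _) = fun N => \sum_(0 <= n < N) eta n u 1%g
     + \sum_(0 <= n < N) eta n v 1%g - \sum_(0 <= n < N) eta n u v).
    by apply: cvgB; [apply: cvgD|]; exact: cpsi.
  apply/funext => N; rewrite -big_split -sumrB; apply: eq_bigr => n _ /=.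
  by rewrite /eta two_point_refl; ring.
have [f fK] := psd_hilbert pK eG.
have fpsi u v : `|f u - f v| ^+ 2 = psi u v.
  have -> : f u - f v = 1 *: f u + (-1) *: f v by rewrite scale1r scaleN1r.
  rewrite sqr_ell2_norm dot_sqr !fK /K !psi_refl.
  by field.
exists S => //; exists (ell2 R), (@dot R), f; split.
  by move=> x; apply: esym; exact: sqr_ell2_norm.
apply: (@coarse_embedding_intro _ _ _ _ _ _ 1%g (fun t => Num.sqrt t)).
- by move=> u v; exact: word_dist_ge0.
- by move=> u v; exact: normr_ge0.
- by move=> t _; exact: sqrtr_ge0.
- by move=> s t _ _; exact: ler_wsqrtr.
- move=> u v; rewrite -[leLHS]ger0_norm ?normr_ge0 // -sqrtr_sqr fpsi.
  by apply: ler_wsqrtr; exact: psi_le.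
move=> M; pose N := (Num.truncn (2 * M ^+ 2)).+1.
have /choice[r hr] n : exists r : R, forall u v,
    r < word_dist R S u v -> two_point (Q n) u v <= 2^-1.
  have [|r hr] := (vanishes_at_infinityP (Q n)).1 (hQ n).2 2^-1; first by [].
  by exists r => u v uv; apply: hr; rewrite graph_dist_cayley.
exists (\big[Num.max/0]_(n < N) r n) => u v uv.
have h1 : M ^+ 2 <= psi u v.
  apply: le_trans (psi_ge u v N).
  apply: (@le_trans _ _ (\sum_(0 <= n < N) 2^-1)).
    rewrite sumr_const_nat subn0 -mulr_natl.
    have := truncnS_gt (2 * M ^+ 2); rewrite -/N; lra.
  apply: ler_sum_nat => n /andP[_ nN].
  have : two_point (Q n) u v <= 2^-1.
    apply: hr; apply: le_lt_trans uv.
    exact: (le_bigmax_cond _ (fun n : 'I_N => r n) (j := Ordinal nN)).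
  by rewrite /eta; lra.
have [M0|M0] := ltP M 0; first by rewrite (le_trans (ltW M0)) ?normr_ge0.
by rewrite -ler_sqr ?nnegrE ?normr_ge0 // fpsi.
Qed.

End FromPercolation.

(** * Percolations from a Hilbert space embedding *)

Lemma word_dist_comparison (R : realType) (G : groupType) (S S' : set G) :
  finite_generating S -> finite_generating S' ->
  exists L : nat, forall g h, word_dist R S' g h <= L%:R * word_dist R S g h.
Proof.
move=> gS gS'; have [L hL] := word_subst gS gS'; exists L => g h.
have [s sw ->] := word_dist_word R g h gS.
have [t tw ts] := hL _ _ sw.
by rewrite (le_trans (word_dist_le R tw)) // -natrM ler_nat.
Qed.

(** Neighbours in the Cayley graph of [S] are at bounded distance for the word metric
    of [S0], hence have images at bounded distance, and distant vertices have distant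
    images, which is what [thresholds] asks for. *)
Lemma percolation_of_hilbert (R : realType) (G : groupType) (S : set G) :
  coarsely_embeds_in_hilbert R G -> cayley_generating S ->
  propertyP R (cayley_edges S).
Proof.
move=> [S0 gS0 [H [inner [f [iN cf]]]]] [gS symS] p p1.
have [e eG] := finite_generating_enum gS.
pose K u v := inner (f u) (f v).
have pK : psd K by apply: psd_gram => x; rewrite iN sqr_ge0.
have dK u v : sqdist K u v = `|f u - f v| ^+ 2.
  rewrite -iN linearBl !linearBr /= /sqdist /K.
  have -> : inner (f v) (f u) = inner (f u) (f v).
    by rewrite (hermitian_subproof (f v)) expr0 mul1r.
  by ring.
have wd0 u v : 0 <= word_dist R S0 u v by exact: word_dist_ge0.
have [L hL] := word_dist_comparison R gS gS0.
have [c hc] := coarse_embedding_near L%:R cf wd0.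
have c0 : 0 <= c ^+ 2 by exact: sqr_ge0.
have eps0 : 0 < (1 - p) / 2 by rewrite divr_gt0 // subr_gt0.
have [b [a [b0 ab near far]]] := thresholds pK eG c0 eps0.
have pair (ed : cayley_edges S) : exists x y, val ed = [set x; y].
  by have [g [s [_ ->]]] := set_valP ed; exists g, (g * s)%g.
have [Q [Qe Qtau]] := percolation_of_thresholds R b0 ab
  (cayley_edges_countable S eG) pair.
exists Q; split=> [ed|].
  have [g [s [Ss eds]]] := set_valP ed.
  have fc : `|f g - f (g * s)%g| <= c.
    apply: hc; apply: (le_trans (hL _ _)); rewrite ler_piMr //.
    apply: (word_dist_le R (s := [:: s])); rewrite mulKg.
    by split; [move=> x; rewrite inE => /eqP ->; left|rewrite big_seq1].
  apply: lt_le_trans (Qe ed g (g * s)%g _ eds _); last first.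
    by apply: near; rewrite dK ler_sqr ?nnegrE ?normr_ge0 // (le_trans _ fc).
  by rewrite lte_fin; lra.
apply/vanishes_at_infinityP => eps e0.
(* The bound [exp (- M)] on the two-point function is at most [eps] for this [M]. *)
have [r hr] := far (- ln eps).
have [r' hr'] := coarse_embedding_far (Num.max 1 r) cf.
have [L' hL'] := word_dist_comparison R gS0 gS.
exists (L'%:R * r') => u v; rewrite graph_dist_cayley // => uv.
(* A distance of at least 1 is at most its square. *)
have fr : Num.max 1 r <= `|f u - f v|.
  apply: hr'; rewrite ltNge; apply/negP => h.
  have := lt_le_trans uv (hL' u v); rewrite ltNge ler_wpM2l //.
have [|n hn] := hr u v.
  have := fr; rewrite ge_max => /andP[x1 xr].
  by rewrite dK (le_trans xr) // expr2 ler_peMr ?normr_ge0.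
apply: le_trans (Qtau u v n) _.
by rewrite -[leRHS]lnK ?posrE // ler_expR lerNl.
Qed.

Theorem corollary1p2 (R : realType) (Gamma : groupType)
    (fg : finitely_generated Gamma) :
  (coarsely_embeds_in_hilbert R Gamma <->
     exists S : set Gamma, cayley_generating S /\ propertyP R (cayley_edges S)) /\
  ((exists S : set Gamma, cayley_generating S /\ propertyP R (cayley_edges S)) <->
     forall S : set Gamma, cayley_generating S -> propertyP R (cayley_edges S)).
Proof.
have [S0 cS0] := cayley_generating_exists fg.
have ba : (exists S : set Gamma, cayley_generating S /\ propertyP R (cayley_edges S)) ->
    coarsely_embeds_in_hilbert R Gamma.
  by move=> [S [cS pS]]; exact: hilbert_of_percolation cS pS.
split; split=> //.
- by move=> h; exists S0; split=> //; exact: percolation_of_hilbert.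
- by move=> /ba h S cS; exact: percolation_of_hilbert.
- by move=> h; exists S0; split=> //; exact: h.
Qed.
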